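(* Let $S$ be a Riemann surface and let $N$ be a Riemannian manifold of class $C^3$. Let $z_0\in S$, $p\in N$ and $v\in T_pN$, and let $z=x+iy$ be a local holomorphic coordinate of $S$ near $z_0$. Then there is a harmonic map $\phi$ of class $C^2$ from a neighborhood of $z_0$ in $S$ to $N$ such that $\phi(z_0)=p$ and $d\phi(z_0)\left(\frac{\partial}{\partial x}\right)=v$.
   Context: A map $f$ of class $C^2$ from an open subset of a Riemann surface to a Riemannian manifold $N$ is harmonic if, in local holomorphic coordinates $z$ on the surface and local coordinates on $N$ with Christoffel symbols $\Gamma^i_{jk}$ of the metric of $N$, it satisfies $\frac{\partial^2 f^i}{\partial z\,\partial\bar z}+\Gamma^i_{jk}(f(z))\frac{\partial f^j}{\partial z}\frac{\partial f^k}{\partial\bar z}=0$ for $i=1,\dots,\dim N$ (summation over repeated indices). *)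

(* Defs.v *)
From HB Require Import structures.
From mathcomp Require Import all_boot all_order all_algebra.
From mathcomp Require Import complex.
From mathcomp Require Import all_classical all_reals all_analysis.

Set Implicit Arguments.
Unset Strict Implicit.
Unset Printing Implicit Defensive.

Import Order.TTheory GRing.Theory Num.Theory.
Import numFieldNormedType.Exports.

Local Open Scope classical_set_scope.
Local Open Scope ring_scope.
Local Open Scope complex_scope.

Section Calculus.
Variable R : realType.

Definition partial (m : nat) (W : normedModType R) (j : 'I_m)
    (f : 'rV[R]_m -> W) (u : 'rV[R]_m) : W :=
  'D_(delta_mx ord0 j) f u.

(* [f] is of class C^k on [A]; only used for open sets [A]. *)
Fixpoint Ck (m : nat) (W : normedModType R) (k : nat)
    (A : set 'rV[R]_m) (f : 'rV[R]_m -> W) : Prop :=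
  match k with
  | 0 => forall u, A u -> {for u, continuous f}
  | k'.+1 => (forall u, A u -> differentiable f u) /\
             (forall j : 'I_m, Ck k' A (partial j f))
  end.

Definition smooth (m : nat) (W : normedModType R)
    (A : set 'rV[R]_m) (f : 'rV[R]_m -> W) : Prop :=
  forall k, Ck k A f.

(* The complex plane is identified with R^2, the row vector (x, y) standing
   for x + i y; the first coordinate has index [ord0], the second
   [ord_max]. *)
Definition toC (u : 'rV[R]_2) : R[i] := u ord0 ord0 +i* u ord0 ord_max.

Definition partialC (j : 'I_2) (h : 'rV[R]_2 -> R[i]) (u : 'rV[R]_2) : R[i] :=
  partial j (fun w => complex.Re (h w)) u +i* partial j (fun w => complex.Im (h w)) u.

Definition d_z (h : 'rV[R]_2 -> R[i]) (u : 'rV[R]_2) : R[i] :=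
  (partialC ord0 h u - 'i%C * partialC ord_max h u) / 2%:R.

Definition d_zbar (h : 'rV[R]_2 -> R[i]) (u : 'rV[R]_2) : R[i] :=
  (partialC ord0 h u + 'i%C * partialC ord_max h u) / 2%:R.

(* Smooth functions satisfying the Cauchy-Riemann equation d/dzbar = 0. By
   Goursat's theorem these are the complex differentiable functions on [A],
   for [A] open. *)
Definition holomorphic (A : set 'rV[R]_2) (h : 'rV[R]_2 -> 'rV[R]_2) : Prop :=
  smooth A h /\ (forall u, A u -> d_zbar (toC \o h) u = 0).

End Calculus.

Section Atlases.
Variables (R : realType) (n : nat) (M : topologicalType).

(* A homeomorphism [chart_coord], with inverse [chart_param], from the open
   subset [chart_dom] of [M] onto an open subset of R^n. Both are total
   functions, whose values outside these open sets are irrelevant. *)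
Record chart := Chart {
  chart_dom : set M ;
  chart_coord : M -> 'rV[R]_n ;
  chart_param : 'rV[R]_n -> M ;
  chart_dom_open : open chart_dom ;
  chart_img_open : open (chart_coord @` chart_dom) ;
  chart_coordK : forall q, chart_dom q -> chart_param (chart_coord q) = q ;
  chart_coordC : forall q, chart_dom q -> {for q, continuous chart_coord} ;
  chart_paramC : forall u, (chart_coord @` chart_dom) u ->
    {for u, continuous chart_param}
}.

Definition transition (c d : chart) : 'rV[R]_n -> 'rV[R]_n :=
  chart_coord d \o chart_param c.

Definition compatible
    (P : set 'rV[R]_n -> ('rV[R]_n -> 'rV[R]_n) -> Prop) (c d : chart) : Prop :=
  P (chart_coord c @` (chart_dom c `&` chart_dom d)) (transition c d) /\
  P (chart_coord d @` (chart_dom c `&` chart_dom d)) (transition d c).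

(* Maximal atlas whose transition maps are of the kind [P]. *)
Definition maximal_atlas
    (P : set 'rV[R]_n -> ('rV[R]_n -> 'rV[R]_n) -> Prop) (A : set chart) :=
  [/\ forall q, exists2 c, A c & chart_dom c q,
      forall c d, A c -> A d -> compatible P c d &
      forall c, (forall d, A d -> compatible P c d) -> A c].

End Atlases.

(* [rs_atlas] consists of all the local holomorphic coordinates. *)
Record riemann_surface (R : realType) (S : topologicalType) := RiemannSurface {
  rs_hausdorff : hausdorff_space S ;
  rs_connected : connected [set: S] ;
  rs_atlas : set (chart R 2 S) ;
  rs_atlasP : maximal_atlas (@holomorphic R) rs_atlas
}.

(* On a manifold of class C^k the components of a tensor field are at most of
   class C^(k-1). [rm_metric c u] is the matrix of the components g_ij, in the
   coordinates [c], of the metric at the point with coordinates [u]; the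
   Jacobian matrix 'J acts on row vectors on the right, whence the form of the
   change of coordinates. *)
Record riemannian_manifold (R : realType) (k n : nat) (N : topologicalType) :=
  RiemannianManifold {
  rm_hausdorff : hausdorff_space N ;
  rm_second_countable : @second_countable N ;
  rm_atlas : set (chart R n N) ;
  rm_atlasP : maximal_atlas (@Ck R n 'rV[R]_n k) rm_atlas ;
  rm_metric : chart R n N -> 'rV[R]_n -> 'M[R]_n ;
  rm_metric_Ck : forall c, rm_atlas c ->
    Ck k.-1 (chart_coord c @` chart_dom c) (rm_metric c) ;
  rm_metric_sym : forall c q, rm_atlas c -> chart_dom c q ->
    (rm_metric c (chart_coord c q))^T = rm_metric c (chart_coord c q) ;
  rm_metric_pos : forall c q (w : 'rV[R]_n), rm_atlas c -> chart_dom c q ->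
    w != 0 -> 0 < (w *m rm_metric c (chart_coord c q) *m w^T) ord0 ord0 ;
  rm_metric_change : forall c d q, rm_atlas c -> rm_atlas d ->
    chart_dom c q -> chart_dom d q ->
    let J := 'J (transition c d) (chart_coord c q) in
    rm_metric c (chart_coord c q) = J *m rm_metric d (chart_coord d q) *m J^T
}.

(* A tangent vector at [p] is given by its components in all the coordinate
   systems around [p], subject to the transformation law. *)
Record tangent (R : realType) (k n : nat) (N : topologicalType)
    (Y : riemannian_manifold R k n N) (p : N) := Tangent {
  tcomp : chart R n N -> 'rV[R]_n ;
  tcomp_change : forall c d, rm_atlas Y c -> rm_atlas Y d ->
    chart_dom c p -> chart_dom d p ->
    tcomp d = 'd (transition c d) (chart_coord c p) (tcomp c)
}.

Definition christoffel (R : realType) (n : nat) (g : 'rV[R]_n -> 'M[R]_n)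
    (u : 'rV[R]_n) (i j k : 'I_n) : R :=
  2%:R^-1 * \sum_(l < n) invmx (g u) i l *
    (partial j (fun w => g w l k : R) u + partial k (fun w => g w l j : R) u
     - partial l (fun w => g w j k : R) u).

Section HarmonicMaps.
Variables (R : realType) (S : topologicalType) (X : riemann_surface R S).
Variables (k n : nat) (N : topologicalType) (Y : riemannian_manifold R k n N).

Definition local_rep (z : chart R 2 S) (c : chart R n N) (f : S -> N) :
    'rV[R]_2 -> 'rV[R]_n :=
  chart_coord c \o f \o chart_param z.

Definition local_dom (z : chart R 2 S) (c : chart R n N) (U : set S)
    (f : S -> N) : set 'rV[R]_2 :=
  chart_coord z @` (chart_dom z `&` U `&` f @^-1` chart_dom c).

Definition map_Ck (l : nat) (U : set S) (f : S -> N) : Prop :=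
  (forall q, U q -> {for q, continuous f}) /\
  (forall z c, rs_atlas X z -> rm_atlas Y c ->
     Ck l (local_dom z c U f) (local_rep z c f)).

Definition harmonic_eq (g : 'rV[R]_n -> 'M[R]_n) (F : 'rV[R]_2 -> 'rV[R]_n)
    (u : 'rV[R]_2) : Prop :=
  let FC i := fun w => (F w ord0 i)%:C in
  forall i : 'I_n,
    d_z (d_zbar (FC i)) u
    + \sum_(j < n) \sum_(l < n)
        (christoffel g (F u) i j l)%:C * d_z (FC j) u * d_zbar (FC l) u = 0.

(* A map from the open set [U] to [N] is represented by a total function whose
   values outside [U] are irrelevant. *)
Definition harmonic_map (U : set S) (f : S -> N) : Prop :=
  map_Ck 2 U f /\
  (forall z c, rs_atlas X z -> rm_atlas Y c ->
   forall u, local_dom z c U f u ->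
   harmonic_eq (rm_metric Y c) (local_rep z c f) u).

(* d f (q) (d/dx) = v, where z = x + i y; meaningful when f q = p. *)
Definition differential_x (f : S -> N) (z : chart R 2 S) (q : S) (p : N)
    (v : tangent Y p) : Prop :=
  forall c, rm_atlas Y c -> chart_dom c p ->
    'd (local_rep z c f) (chart_coord z q) (delta_mx ord0 ord0) = tcomp v c.

End HarmonicMaps.

(* Main.v *)
Require Import Defs.
From mathcomp Require Import all_boot all_order all_algebra.
From mathcomp Require Import complex.
From mathcomp Require Import all_classical all_reals all_analysis.
From mathcomp Require Import ring lra.
Import numFieldNormedType.Exports.
Local Open Scope classical_set_scope.

(** A harmonic map with prescribed value and prescribed derivative in one
    direction need not depend on both variables: if [gamma] is a geodesic of [N]
    with [gamma (Re (z z0)) = p] and velocity [v] there, then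
    [phi q = gamma (Re (z q))] is harmonic near [z0]. Indeed, in the coordinate
    [z = x + i y], the harmonic map equation for a function of [x] alone is a
    quarter of the geodesic equation.

    The geodesic exists by the Picard-Lindelof theorem
    ([picard_lindelof_lip]), since the metric is of class C^2 and the
    acceleration is therefore locally Lipschitz in position and velocity
    ([geodesic_exists]).

    The harmonic map equation must hold in every pair of charts. In charts [z']
    of the surface and [d] of [N], [phi] is represented by [T \o x \o h], where
    [x] is the geodesic in a fixed chart, [T] is a transition map of [N] and [h]
    is the real part of a holomorphic transition map. Two facts give the
    equation there:
    - [h] is harmonic, by the Cauchy-Riemann equations, and composing a curve
      with [h] turns the geodesic equation into the harmonic map equation
      ([re_holomorphic_laplace], [harmonic_curve]);
    - [T \o x] is a geodesic for the metric in the chart [d]. This is proved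
      with the Euler-Lagrange form of the geodesic equation, which transforms
      as a covector ([euler_lagrange_covariant], [euler_lagrange_change]); the
      Christoffel symbols only appear at the end ([geodesic_christoffel]).

    Both facts rest on the symmetry of second derivatives ([schwarz]). *)

Set Implicit Arguments.
Unset Strict Implicit.
Unset Printing Implicit Defensive.

Import Order.TTheory GRing.Theory Num.Theory.

Local Open Scope ring_scope.

(** * Differential calculus in coordinates *)

Section Calculus.
Variable R : realType.

Lemma rV_norm_coord m (x : 'rV[R]_m) i : `|x ord0 i| <= `|x|.
Proof.
rewrite [leRHS]/Num.Def.normr/= mx_normrE.
exact: (le_bigmax _ (fun ij : 'I_1 * 'I_m => `|x ij.1 ij.2|) (ord0, i)).
Qed.

Lemma rV_norm_le m (x : 'rV[R]_m) c :
  0 <= c -> (forall i, `|x ord0 i| <= c) -> `|x| <= c.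
Proof.
move=> c0 xc; rewrite [leLHS]/Num.Def.normr/= mx_normrE bigmax_le// => -[i j] _.
by rewrite ord1 /=.
Qed.

Lemma norm_delta m (j : 'I_m) : `|delta_mx ord0 j : 'rV[R]_m| <= 1.
Proof.
apply: rV_norm_le => // i; rewrite mxE.
by case: (_ && _); rewrite ?normr1 ?normr0.
Qed.

Lemma derive_partial m (W : normedModType R) (f : 'rV[R]_m -> W) u v :
  differentiable f u -> 'D_v f u = \sum_j v ord0 j *: partial j f u.
Proof.
move=> df; rewrite deriveE // {1}(row_sum_delta v) linear_sum.
by apply: eq_bigr => j _; rewrite linearZ /= /partial deriveE.
Qed.

(** One chain rule serves for curves (real parameter, direction 1) and for
    partial derivatives of a composite, because the parameter space is an
    arbitrary normed module. *)
Lemma is_derive_chain (V : normedModType R) m (f : 'rV[R]_m -> R)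
    (c : V -> 'rV[R]_m) u v :
  differentiable c u -> differentiable f (c u) ->
  is_derive u v (f \o c) (\sum_j ('D_v c u) ord0 j * partial j f (c u)).
Proof.
move=> dc df; have dfc : differentiable (f \o c) u by exact: differentiable_comp.
apply: DeriveDef; first exact: diff_derivable.
by rewrite deriveE// diff_comp//= -deriveE// -deriveE// derive_partial.
Qed.

Lemma derive_coord (V : normedModType R) m (f : V -> 'rV[R]_m) u v i :
  derivable f u v -> ('D_v f u) ord0 i = 'D_v (fun x => f x ord0 i) u.
Proof. by move=> df; rewrite derive_mx// mxE. Qed.

Lemma is_derive_coord (V : normedModType R) m (f : V -> 'rV[R]_m) u v
    (df : 'rV[R]_m) i :
  is_derive u v f df -> is_derive u v (fun x => f x ord0 i) (df ord0 i).
Proof.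
move=> [d1 d2]; apply: DeriveDef; first by have /derivable_mxP := d1; exact.
by rewrite -(derive_coord i d1) d2.
Qed.

Lemma is_derive_rV (V : normedModType R) m (f : V -> 'rV[R]_m) u v (df : 'rV[R]_m) :
  (forall i, is_derive u v (fun x => f x ord0 i) (df ord0 i)) ->
  is_derive u v f df.
Proof.
move=> H; have dV : derivable f u v.
  by apply/derivable_mxP => i j; rewrite (ord1 i); have [dd _] := H j; exact: dd.
apply: DeriveDef; first exact: dV.
apply/rowP => i; rewrite (derive_coord i dV).
by have [_ dd] := H i; exact: dd.
Qed.

Lemma partial_coord m n (f : 'rV[R]_m -> 'rV[R]_n) j i u :
  differentiable f u ->
  (partial j f u) ord0 i = partial j (fun x => f x ord0 i) u.
Proof. by move=> df; rewrite /partial derive_coord//; exact: diff_derivable. Qed.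

Lemma differentiable_entry (V : normedModType R) m n (f : V -> 'M[R]_(m, n)) u i j :
  differentiable f u -> differentiable (fun x => f x i j) u.
Proof.
move=> df; apply: (@differentiable_comp _ _ _ _ f (fun N : 'M[R]_(m, n) => N i j)) => //.
exact: differentiable_coord.
Qed.

Lemma differentiable_rV (V : normedModType R) m (f : V -> 'rV[R]_m) u :
  (forall i, differentiable (fun x => f x ord0 i) u) -> differentiable f u.
Proof.
move=> df.
have -> : f = \sum_i (fun x => f x ord0 i *: delta_mx ord0 i).
  apply/funext => x; rewrite fct_sumE; exact: row_sum_delta.
by apply: differentiable_sum => i; exact: differentiableZl.
Qed.

Lemma continuous_rV (T : topologicalType) m (f : T -> 'rV[R]_m) u :
  (forall i, {for u, continuous (fun x => f x ord0 i)}) -> {for u, continuous f}.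
Proof.
move=> cf; apply/cvgrPdist_le => /= e e0; near=> x.
apply: rV_norm_le; first exact: ltW.
move=> i; rewrite !mxE; move: i; near: x; apply: filter_forall => i.
by have /cvgrPdist_le/(_ _ e0) := cf i.
Unshelve. all: by end_near. Qed.

Lemma continuous_entry (T : topologicalType) m n (f : T -> 'M[R]_(m, n)) u i j :
  {for u, continuous f} -> {for u, continuous (fun x => f x i j)}.
Proof.
move=> cf; apply: (@continuous_comp _ _ _ f (fun N : 'M[R]_(m, n) => N i j)) => //.
exact: coord_continuous.
Qed.

Lemma Ck_subset m (W : normedModType R) k (A B : set 'rV[R]_m) (f : _ -> W) :
  A `<=` B -> Ck k B f -> Ck k A f.
Proof.
move=> AB; elim: k f => [|k IH] f /= H; first by move=> u /AB; exact: H.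
case: H => H1 H2; split; first by move=> u /AB; exact: H1.
by move=> j; exact: IH.
Qed.

Lemma partial_near m (W : normedModType R) (f g : 'rV[R]_m -> W) j u :
  {near u, f =1 g} -> partial j f u = partial j g u.
Proof. exact: near_eq_derive. Qed.

(** The derivative of a difference vanishing near the point is zero, so the
    class [Ck] only depends on germs; this is what allows a partial derivative
    to be replaced by an explicit formula before it is differentiated again. *)
Lemma differentiable_near (V W : normedModType R) (f g : V -> W) u :
  {near u, f =1 g} -> differentiable f u -> differentiable g u.
Proof.
move=> fg df; have -> : g = f + (g - f) by rewrite addrC subrK.
apply: differentiableD; first exact: df.
have dE : (g - f) \o shift u = cst ((g - f) u) + (\0 : {linear V -> W}) +o_ 0 id.
  apply/eqaddoP => e e0; near=> h.
  rewrite !fctE /= addr0 (nbhs_singleton fg) subrr subr0.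
  have -> : f (h + u) = g (h + u).
    by near: h; move: fg; rewrite (near_shift 0)/=; apply: filterS => h; rewrite subr0.
  by rewrite subrr normr0 mulr_ge0// ltW.
by apply/diff_locallyP; rewrite (diff_unique _ dE); [split=> //|]; exact: cst_continuous.
Unshelve. all: by end_near. Qed.

Lemma continuous_near (T U : topologicalType) (f g : T -> U) u :
  {near u, f =1 g} -> {for u, continuous f} -> {for u, continuous g}.
Proof.
move=> fg cf; rewrite /prop_for /continuous_at -(nbhs_singleton fg).
by move: cf; apply: cvg_trans; exact: near_eq_cvg.
Qed.

Lemma open_near_eq (T : topologicalType) U (A : set T) (f g : T -> U) u :
  open A -> A u -> {in A, f =1 g} -> {near u, f =1 g}.
Proof.
move=> oA Au fg; have := open_nbhs_nbhs (conj oA Au).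
by apply: filterS => x Ax; apply: fg; rewrite inE.
Qed.

Lemma Ck_eq m (W : normedModType R) k (A : set 'rV[R]_m) (f g : _ -> W) :
  open A -> {in A, f =1 g} -> Ck k A f -> Ck k A g.
Proof.
move=> oA; elim: k f g => [|k IH] f g fg /=.
  by move=> cf u Au; apply: continuous_near (cf u Au); exact: open_near_eq fg.
move=> [df pf]; split.
  by move=> u Au; apply: differentiable_near (df u Au); exact: open_near_eq fg.
move=> j; apply: IH (pf j) => u; rewrite inE => Au.
by apply: partial_near; exact: open_near_eq fg.
Qed.

Lemma CkW m (W : normedModType R) k (A : set 'rV[R]_m) (f : _ -> W) :
  Ck k.+1 A f -> Ck k A f.
Proof.
elim: k f => [|k IH] f /= [df pf].
  by move=> u Au; apply: differentiable_continuous; exact: df.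
by split=> // j; apply: IH; exact: pf.
Qed.

Lemma CkD m (W : normedModType R) k (A : set 'rV[R]_m) (f g : _ -> W) :
  open A -> Ck k A f -> Ck k A g -> Ck k A (f + g).
Proof.
move=> oA; elim: k f g => [|k IH] f g /=.
  by move=> cf cg u Au; apply: continuousD; [exact: cf|exact: cg].
move=> [df pf] [dg pg]; split.
  by move=> u Au; apply: differentiableD; [exact: df|exact: dg].
move=> j; apply: Ck_eq (IH _ _ (pf j) (pg j)) => // u; rewrite inE => Au.
by rewrite /partial deriveD//; apply: diff_derivable; [exact: df|exact: dg].
Qed.

Lemma CkM m k (A : set 'rV[R]_m) (f g : _ -> R) :
  open A -> Ck k A f -> Ck k A g -> Ck k A (f * g).
Proof.
move=> oA; elim: k f g => [|k IH] f g.
  by move=> cf cg u Au; apply: continuousM; [exact: cf|exact: cg].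
move=> Cf Cg; have := CkW Cf; have := CkW Cg; move: Cf Cg.
move=> [df pf] [dg pg] Cg Cf; split.
  by move=> u Au; apply: differentiableM; [exact: df|exact: dg].
move=> j; have := CkD oA (IH _ _ Cf (pg j)) (IH _ _ Cg (pf j)).
apply: Ck_eq => // u; rewrite inE => Au.
by rewrite /partial deriveM//; apply: diff_derivable; [exact: df|exact: dg].
Qed.

Lemma Ck_entry m k p q (A : set 'rV[R]_m) (f : _ -> 'M[R]_(p, q)) i j :
  open A -> Ck k A f -> Ck k A (fun u => f u i j).
Proof.
move=> oA; elim: k f => [|k IH] f /=.
  by move=> cf u Au; apply: continuous_entry; exact: cf.
move=> [df pf]; split; first by move=> u Au; apply: differentiable_entry; exact: df.
move=> l; apply: Ck_eq (IH _ (pf l)) => // u; rewrite inE => Au.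
by rewrite /partial derive_mx ?mxE//; apply: diff_derivable; exact: df.
Qed.

Lemma Ck_rV m k p (A : set 'rV[R]_m) (f : _ -> 'rV[R]_p) :
  open A -> (forall i, Ck k A (fun u => f u ord0 i)) -> Ck k A f.
Proof.
move=> oA; elim: k f => [|k IH] f /= Cf.
  by move=> u Au; apply: continuous_rV => i; exact: Cf.
have df u : A u -> differentiable f u.
  by move=> Au; apply: differentiable_rV => i; have [+ _] := Cf i; exact.
split=> // j; apply: IH => i; have [_ /(_ j)] := Cf i.
apply: Ck_eq => // u; rewrite inE => Au; rewrite partial_coord//; exact: df.
Qed.

Lemma is_derive_comp1 (V : normedModType R) (s : R -> R) (h : V -> R) u v ds :
  is_derive (h u) (1 : R) s ds -> differentiable h u ->
  is_derive u v (s \o h) (ds * 'D_v h u).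
Proof.
move=> [ds1 ds2] dh.
have ds' : differentiable s (h u) by exact/derivable1_diffP.
apply: DeriveDef; first by apply: diff_derivable; exact: differentiable_comp.
rewrite deriveE; last exact: differentiable_comp.
by rewrite diff_comp//= diff1E// -deriveE// derive1E ds2 /GRing.scale/= mulrC.
Qed.

Lemma differentiable_comp1 (V : normedModType R) (s : R -> R) (h : V -> R) u ds :
  is_derive (h u) (1 : R) s ds -> differentiable h u -> differentiable (s \o h) u.
Proof.
move=> [ds1 ds2] dh; apply: differentiable_comp => //.
exact/derivable1_diffP.
Qed.

(** A function [s] of one real variable composed with a scalar function [h]:
    this is the shape of the local representatives of a map which depends on
    the real part of a holomorphic coordinate only. *)
Section CurveComp.
Variables (m : nat) (O : set 'rV[R]_m) (I : set R) (h : 'rV[R]_m -> R).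
Variables (s s1 s2 : R -> R).
Hypothesis oO : open O.
Hypothesis Ch : Ck 2 O h.
Hypothesis OI : forall u, O u -> I (h u).
Hypothesis ds : forall t, I t -> is_derive t (1 : R) s (s1 t).
Hypothesis ds1 : forall t, I t -> is_derive t (1 : R) s1 (s2 t).
Hypothesis cs2 : forall t, I t -> {for t, continuous s2}.

Lemma partial_curve_comp a u :
  O u -> partial a (s \o h) u = s1 (h u) * partial a h u.
Proof.
move=> Ou; rewrite /partial; apply: (@derive_val).
by apply: is_derive_comp1; [apply: ds; exact: OI|exact: Ch.1].
Qed.

Lemma partial2_curve_comp a b u : O u -> partial b (partial a (s \o h)) u =
  s2 (h u) * partial b h u * partial a h u +
  s1 (h u) * partial b (partial a h) u.
Proof.
move=> Ou.
rewrite (@partial_near _ _ _ (fun w => s1 (h w) * partial a h w)); last first.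
  apply: (open_near_eq oO Ou) => w; rewrite inE => Ow.
  exact: partial_curve_comp.
have dh := Ch.1 _ Ou; have dah := (Ch.2 a).1 _ Ou.
have d1 := is_derive_comp1 (delta_mx ord0 b) (ds1 (OI Ou)) dh.
have d2 := derivableP (diff_derivable (v := delta_mx ord0 b) dah).
have := @derive_val _ _ _ _ _ _ _ (is_deriveM d1 d2).
rewrite /partial => ->.
by rewrite addrC /GRing.scale/= [X in X + _ = _]mulrC.
Qed.

Lemma Ck2_curve_comp : Ck 2 O (s \o h).
Proof.
have C0 : Ck 0 O (s2 \o h).
  move=> u Ou; apply: continuous_comp; last exact/cs2/OI.
  exact/differentiable_continuous/Ch.1.
have C1 : Ck 1 O (s1 \o h).
  split=> [u Ou|j].
    by apply: differentiable_comp1; [exact/ds1/OI|exact: Ch.1].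
  have := CkM oO C0 (@CkW _ _ 0 _ _ (Ch.2 j)); apply: Ck_eq => // u; rewrite inE => Ou.
  apply/esym; rewrite /partial; apply: (@derive_val).
  by apply: is_derive_comp1; [apply: ds1; exact: OI|exact: Ch.1].
split=> [u Ou|j].
  by apply: differentiable_comp1; [exact/ds/OI|exact: Ch.1].
have := CkM oO C1 (Ch.2 j); apply: Ck_eq => // u; rewrite inE => Ou.
by rewrite partial_curve_comp.
Qed.

End CurveComp.

Lemma is_derive_line (V : normedModType R) (f : V -> R) u v s :
  differentiable f (u + s *: v) ->
  is_derive s (1 : R) (fun t : R => f (u + t *: v)) ('D_v f (u + s *: v)).
Proof.
move=> df.
have dl : is_diff s (fun t : R => u + t *: v) ( *:%R^~ v).
  have := is_diffD (is_diff_cst u s) (is_diff_scalel s v).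
  by rewrite add0r.
have dfl : differentiable (f \o (fun t : R => u + t *: v)) s.
  exact: differentiable_comp.
apply: DeriveDef; first exact: diff_derivable.
by rewrite deriveE// diff_comp//= diff_val/= scale1r deriveE.
Qed.

(** Restricting to the line through [u] in the direction [v] reduces every
    mean value argument below to one variable. *)
Lemma MVT_line (V : normedModType R) (f : V -> R) u v h :
  0 < h -> (forall s, 0 <= s <= h -> differentiable f (u + s *: v)) ->
  exists2 s, 0 < s < h & f (u + h *: v) - f u = h * 'D_v f (u + s *: v).
Proof.
move=> h0 df.
have [||s] := @MVT _ (fun t : R => f (u + t *: v))
  (fun s => 'D_v f (u + s *: v)) 0 h h0.
- move=> x; rewrite in_itv/= => /andP[x0 xh].
  by apply: is_derive_line; apply: df; rewrite !ltW.
- apply: derivable_within_continuous => x; rewrite in_itv/= => xh.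
  by have [] := is_derive_line (df _ xh).
rewrite in_itv/= => sh; rewrite scale0r addr0 subr0 => E; exists s => //.
by rewrite E mulrC.
Qed.

Lemma nbhs_dist (V : normedModType R) (P : set V) u :
  nbhs u P -> exists2 d, 0 < d & forall x, `|x - u| < d -> P x.
Proof.
move=> /nbhs_ballP[d /= d0 dP]; exists d => // x xu.
by apply: dP; rewrite -ball_normE/= distrC.
Qed.

Lemma is_diff_translate (V : normedModType R) (f : V -> R) u c :
  differentiable f (u + c) -> is_diff u (fun x => f (x + c)) ('d f (u + c)).
Proof.
move=> df.
have dsh : is_diff u (fun x : V => x + c) id.
  by have := is_diffD (is_diff_id u) (is_diff_cst c u); rewrite addr0.
exact: (@is_diff_comp _ _ _ _ _ _ _ _ _ dsh (differentiableP df)).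
Qed.

(** Two applications of the mean value theorem turn the second difference into
    a mixed derivative at a nearby point. The left-hand side is symmetric in
    [j] and [k] while the right-hand side is not, whence Schwarz's theorem. *)
Lemma second_difference m (f : 'rV[R]_m -> R) (B : set 'rV[R]_m) u d h j k :
  Ck 2 B f -> (forall x, `|x - u| < d -> B x) -> 0 < h -> h *+ 2 < d ->
  exists2 w, `|w - u| <= h *+ 2 &
   f (u + h *: delta_mx ord0 j + h *: delta_mx ord0 k) - f (u + h *: delta_mx ord0 j)
   - f (u + h *: delta_mx ord0 k) + f u = h * (h * partial k (partial j f) w).
Proof.
move=> Cf dB h0 hd; set ej := delta_mx _ j; set ek := delta_mx _ k.
have bnd s t : 0 <= s <= h -> 0 <= t <= h ->
    `|u + t *: ek + s *: ej - u| <= h *+ 2.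
  move=> /andP[s0 sh] /andP[t0 th]; rewrite addrC addrA addrA addNr add0r.
  rewrite (le_trans (ler_normD _ _))// mulr2n lerD// normrZ ger0_norm//.
    by rewrite -[h]mulr1 ler_pM// norm_delta.
  by rewrite -[h]mulr1 ler_pM// norm_delta.
have hh : 0 <= h <= h by rewrite lexx ltW.
have z0 : 0 <= (0 : R) <= h by rewrite lexx ltW.
have inB s t : 0 <= s <= h -> 0 <= t <= h -> B (u + t *: ek + s *: ej).
  by move=> sh th; apply: dB; apply: le_lt_trans hd; exact: bnd.
have d1 s : 0 <= s <= h -> differentiable f (u + s *: ej).
  by move=> sh; apply: Cf.1; have := inB _ _ sh z0; rewrite scale0r addr0.
have d2 s : 0 <= s <= h -> differentiable f (u + s *: ej + h *: ek).
  by move=> sh; apply: Cf.1; rewrite (addrAC u); exact: inB.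
have d3 s (sh : 0 <= s <= h) := is_diff_translate (d2 s sh).
have [s0 sh|s s0h E1] := @MVT_line _ (fun x => f (x + h *: ek) - f x) u ej h h0.
  by apply: differentiableB; [exact: (@ex_diff _ _ _ _ _ _ _ (d3 _ sh))|exact: d1].
have sh : 0 <= s <= h by case/andP: s0h => *; rewrite !ltW.
have [t th|t t0h E2] := @MVT_line _ (partial j f) (u + s *: ej) ek h h0.
  by apply: (Cf.2 j).1; rewrite addrAC; exact: inB.
have th : 0 <= t <= h by case/andP: t0h => *; rewrite !ltW.
exists (u + s *: ej + t *: ek); first by rewrite [u + _ + _]addrAC; exact: bnd.
rewrite -[X in h * (h * X)]/('D_ek (partial j f) (u + s *: ej + t *: ek)) -E2.
have -> : f (u + h *: ej + h *: ek) - f (u + h *: ej) - f (u + h *: ek) + f u =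
  f (u + h *: ej + h *: ek) - f (u + h *: ej) - (f (u + h *: ek) - f u) by ring.
rewrite E1; congr (_ * _).
rewrite [LHS]deriveE; last first.
  by apply: differentiableB; [exact: (@ex_diff _ _ _ _ _ _ _ (d3 _ sh))|exact: d1].
have := is_diffB (d3 _ sh) (differentiableP (d1 _ sh)) => /(@diff_val _ _ _ _ _ _ _) ->.
apply: esym; rewrite /partial.
by congr (_ - _); [exact: (deriveE _ (d2 _ sh))|exact: (deriveE _ (d1 _ sh))].
Qed.

Lemma schwarz m (f : 'rV[R]_m -> R) (B : set 'rV[R]_m) u j k :
  open B -> Ck 2 B f -> B u ->
  partial j (partial k f) u = partial k (partial j f) u.
Proof.
move=> oB Cf Bu; apply/eqP; rewrite -subr_eq0 -normr_le0.
apply/ler_addgt0Pr => e e0; rewrite add0r.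
have e20 : 0 < e / 2 by rewrite divr_gt0.
have /nbhs_dist[d1 d10 dB] := open_nbhs_nbhs (conj oB Bu).
have /cvgrPdist_le/(_ _ e20)/nbhs_dist[d2 d20 H2] := (Cf.2 k).2 j u Bu.
have /cvgrPdist_le/(_ _ e20)/nbhs_dist[d3 d30 H3] := (Cf.2 j).2 k u Bu.
pose d := Num.min d1 (Num.min d2 d3).
have d0 : 0 < d by rewrite !lt_min d10 d20 d30.
(* so that the points at distance [h *+ 2] are still closer than [d] *)
pose h := d / 4.
have h0 : 0 < h by rewrite divr_gt0.
have hd : h *+ 2 < d by rewrite /h; lra.
have dB' x : `|x - u| < d -> B x.
  move=> xu; apply: dB; rewrite (lt_le_trans xu)//.
  by rewrite /d ge_min lexx.
have [w wu E] := second_difference j k Cf dB' h0 hd.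
have [w' wu' E'] := second_difference k j Cf dB' h0 hd.
have EE : partial j (partial k f) w' = partial k (partial j f) w.
  have hne : h != 0 by rewrite gt_eqF.
  apply: (mulfI hne); apply: (mulfI hne); apply: etrans (esym E') _.
  apply: etrans E; rewrite (addrAC u); congr (_ + _).
  by rewrite -!addrA; congr (_ + _); exact: addrC.
have B2 : `|w' - u| < d2.
  apply: le_lt_trans wu' _; apply: lt_le_trans hd _.
  by rewrite /d !ge_min lexx orbT.
have B3 : `|w - u| < d3.
  apply: le_lt_trans wu _; apply: lt_le_trans hd _.
  by rewrite /d !ge_min lexx !orbT.
have H4 := H2 _ B2; rewrite EE in H4.
rewrite (splitr e); apply: le_trans (ler_distD (partial k (partial j f) w) _ _) _.
by apply: lerD; [exact: H4|rewrite distrC; exact: H3].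
Qed.

(** The Lipschitz condition is asked on a whole ball around the point, not
    only with respect to its centre. *)
Definition lip_at (V W : normedModType R) (f : V -> W) (x0 : V) :=
  exists K r, [/\ 0 <= K, 0 < r & forall x y, `|x - x0| < r -> `|y - x0| < r ->
    `|f x - f y| <= K * `|x - y|].

(** Balls are convex, so the mean value theorem on a segment bounds the
    difference by the sum of the suprema of the partial derivatives. *)
Lemma Ck1_lip_at m (f : 'rV[R]_m -> R) (B : set 'rV[R]_m) u :
  open B -> Ck 1 B f -> B u -> lip_at f u.
Proof.
move=> oB Cf Bu.
pose K := \sum_j (`|partial j f u| + 1).
have K0 : 0 <= K by apply: sumr_ge0 => j _; rewrite addr_ge0.
have : \forall x \near u, B x /\ forall j, `|partial j f x| <= `|partial j f u| + 1.
  near=> x; split; first by near: x; exact: open_nbhs_nbhs.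
  move=> j; move: j; near: x; apply: filter_forall => j.
  have /cvgrPdist_le/(_ _ ltr01) := Cf.2 j u Bu; apply: filterS => x Hx.
  have -> : partial j f x = partial j f u - (partial j f u - partial j f x) by ring.
  by rewrite (le_trans (ler_normB _ _))// lerD2l.
move=> /nbhs_dist[r r0 Hr]; exists K, r; split=> // x y xr yr.
have cvx s : 0 <= s <= 1 -> `|y + s *: (x - y) - u| < r.
  move=> /andP[s0 s1].
  have -> : y + s *: (x - y) - u = s *: (x - u) + (1 - s) *: (y - u).
    by apply/rowP => i; rewrite !mxE; ring.
  apply: le_lt_trans (ler_normD _ _) _; rewrite !normrZ !ger0_norm ?subr_ge0//.
  move: xr yr; move: `|x - u| `|y - u| => p q pr qr.
  apply: (@le_lt_trans _ _ (Num.max p q)); last by rewrite gt_max pr qr.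
  have : p <= Num.max p q by rewrite le_max lexx.
  have : q <= Num.max p q by rewrite le_max lexx orbT.
  move: (Num.max p q) => M qM pM; nra.
have [s sh|s s01 E] := @MVT_line _ f y (x - y) 1 ltr01.
  by apply: Cf.1; have [] := Hr _ (cvx _ sh).
rewrite scale1r (addrC y) subrK in E.
have sh : 0 <= s <= 1 by case/andP: s01 => *; rewrite !ltW.
have [Bs Hs] := Hr _ (cvx _ sh).
rewrite E mul1r derive_partial; last exact: Cf.1.
apply: le_trans (ler_norm_sum _ _ _) _; rewrite /K mulr_suml; apply: ler_sum => j _.
rewrite normrM mulrC; apply: ler_pM; [exact: normr_ge0..|exact: Hs|].
exact: rV_norm_coord.
Unshelve. all: by end_near. Qed.

End Calculus.

(** * Local existence for ordinary differential equations *)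

Section Picard.
Variable R : realType.

Lemma nbhs_dist_lt (V : normedModType R) (x : V) e :
  0 < e -> \forall y \near x, `|x - y| < e.
Proof.
move=> e0; have /cvgrPdist_lt/(_ _ e0) : y @[y --> x] --> x by exact: cvg_id.
exact.
Qed.

Lemma lipschitz_continuous (V W : normedModType R) (f : V -> W) y0 K r x :
  0 <= K -> (forall x y, `|x - y0| < r -> `|y - y0| < r ->
    `|f x - f y| <= K * `|x - y|) ->
  `|x - y0| < r -> {for x, continuous f}.
Proof.
move=> K0 lipf xr; apply/cvgrPdist_lt => e e0; near=> y.
apply: (@le_lt_trans _ _ (K * `|x - y|)).
  apply: lipf => //.
  have -> : y - y0 = (x - y0) - (x - y).
    by rewrite opprB [RHS]addrC addrA subrK.
  apply: le_lt_trans (ler_normB _ _) _; rewrite -ltrBrDl; near: y.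
  by apply: nbhs_dist_lt; rewrite subr_gt0.
apply: (@le_lt_trans _ _ ((K + 1) * `|x - y|)); first by rewrite ler_wpM2r// lerDl.
rewrite mulrC -ltr_pdivlMr ?ltr_wpDl//; near: y.
by apply: nbhs_dist_lt; rewrite divr_gt0// ltr_wpDl.
Unshelve. all: by end_near. Qed.

(** The intervals of radius [c *+ 2 / 2 ^+ k] around [u k] are nested, so the
    supremum of their left endpoints belongs to all of them. *)
Lemma geometric_limit (u : nat -> R) c :
  (forall k, `|u k.+1 - u k| <= c / 2 ^+ k) ->
  exists l, forall k, `|l - u k| <= c *+ 2 / 2 ^+ k.
Proof.
move=> uc; pose e k : R := c *+ 2 / 2 ^+ k.
have eS k : e k.+1 = c / 2 ^+ k.
  rewrite /e exprS invfM mulrA; congr (_ / _).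
  by rewrite -mulr_natr mulfK.
have e2 k : e k = e k.+1 + e k.+1 by rewrite eS /e mulr2n mulrDl.
have e0 k : 0 <= e k by rewrite e2 eS; have := le_trans (normr_ge0 _) (uc k); lra.
have step k : u k - e k <= u k.+1 - e k.+1 /\ u k.+1 + e k.+1 <= u k + e k.
  by have := uc k; rewrite -eS ler_norml => /andP[]; rewrite (e2 k); lra.
have low k j : u k - e k <= u (k + j)%N - e (k + j)%N.
  by elim: j => [|j IH]; rewrite ?addn0// addnS (le_trans IH)//; case: (step (k + j)%N).
have high k j : u (k + j)%N + e (k + j)%N <= u k + e k.
  by elim: j => [|j IH]; rewrite ?addn0// addnS (le_trans _ IH)//; case: (step (k + j)%N).
have lowhigh k j : u k - e k <= u j + e j.
  apply: le_trans (low k j) _; rewrite addnC; apply: le_trans (high j k).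
  by have := e0 (j + k)%N; lra.
pose A := [set u k - e k | k in [set: nat]].
have A0 : A !=set0 by exists (u 0%N - e 0%N), 0%N.
have ubA j : ubound A (u j + e j) by move=> _ [k _ <-].
exists (sup A) => k; rewrite -/(e k) ler_norml; apply/andP; split.
  suff : u k - e k <= sup A by lra.
  by apply: ub_le_sup; [exists (u 0%N + e 0%N); exact: ubA|exists k].
suff : sup A <= u k + e k by lra.
by apply: ge_sup.
Qed.

Lemma geometric_limit_rV m (u : nat -> 'rV[R]_m) c : 0 <= c ->
  (forall k, `|u k.+1 - u k| <= c / 2 ^+ k) ->
  exists l, forall k, `|l - u k| <= c *+ 2 / 2 ^+ k.
Proof.
move=> c0 uc.
have /choice[l Hl] i : exists l, forall k, `|l - u k ord0 i| <= c *+ 2 / 2 ^+ k.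
  apply: geometric_limit => k; apply: le_trans (uc k).
  by have := rV_norm_coord (u k.+1 - u k) i; rewrite !mxE.
exists (\row_i l i) => k; apply: rV_norm_le.
  by rewrite divr_ge0// ?exprn_ge0// mulrn_wge0.
by move=> i; rewrite !mxE.
Qed.

Lemma le_geometric (x c : R) : (forall k, x <= c / 2 ^+ k) -> x <= 0.
Proof.
move=> H; rewrite leNgt; apply/negP => x0.
have c0 : 0 < c by have := H 0%N; rewrite expr0 divr1; exact: lt_le_trans.
have [k ck] : exists k : nat, c / x < 2 ^+ k.
  exists (Num.truncn (c / x)).+1.
  apply: lt_le_trans (truncnS_gt _) _.
  by rewrite -natrX ler_nat ltnW// ltn_expl.
have := H k; rewrite leNgt => /negP; apply.
rewrite ltr_pdivrMr ?exprn_gt0//.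
by move: ck; rewrite ltr_pdivrMr// mulrC.
Qed.

Lemma mean_value_bound (f df : R -> R) t0 b d t :
  (forall s, `|s - t0| < b -> is_derive s (1 : R) f (df s)) ->
  (forall s, `|s - t0| < b -> `|df s| <= d) -> `|t - t0| < b ->
  `|f t - f t0| <= `|t - t0| * d.
Proof.
move=> Hf Hd tb.
have inb s : 0 <= s <= 1 -> `|t0 + s *: (t - t0) - t0| < b.
  move=> /andP[s0 s1]; rewrite addrC addKr normrZ ger0_norm//.
  by apply: le_lt_trans tb; rewrite ler_piMl.
have df' s : 0 <= s <= 1 -> differentiable f (t0 + s *: (t - t0)).
  by move=> /inb/Hf[? _]; exact/derivable1_diffP.
have [s s01] := MVT_line ltr01 df'.
have sh : 0 <= s <= 1 by case/andP: s01 => *; rewrite !ltW.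
rewrite scale1r (addrC t0) subrK mul1r => ->.
rewrite deriveE; last exact: df'.
rewrite diff1E; last exact: df'.
rewrite derive1E (@derive_val _ _ _ _ _ _ _ (Hf _ (inb _ sh))) normrM ler_wpM2l//.
exact/Hd/inb.
Qed.

(** The interval of integration starts at [t0 - b], so that the primitive is
    differentiable on both sides of [t0]. *)
Definition primitive (t0 b : R) (f : R -> R) (t : R) : R :=
  (\int[lebesgue_measure]_(s in `[t0 - b, t]) f s)%R -
  (\int[lebesgue_measure]_(s in `[t0 - b, t0]) f s)%R.

Lemma is_derive_primitive t0 b f t : continuous f -> `|t - t0| < b ->
  is_derive t (1 : R) (primitive t0 b f) (f t).
Proof.
move=> cf; rewrite ltr_norml => /andP[tb1 tb2].
have tb : t < t0 + b by lra.
have [||d1 d2] := @continuous_FTC1_closed _ f (t0 - b) t (t0 + b) tb _ _ (cf t).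
- apply: continuous_compact_integrable; first exact: segment_compact.
  exact: continuous_subspaceT.
- lra.
rewrite derive1E in d2.
apply: is_derive_eq (is_deriveB (derivableP d1) (is_derive_cst _ _ _)) _.
by rewrite subr0; exact: d2.
Qed.

Lemma primitive0 t0 b f : primitive t0 b f t0 = 0.
Proof. exact: subrr. Qed.

(** Picard iteration: the integral operator halves distances on a short time
    interval, so its iterates form geometric sequences and their pointwise
    limit is a fixed point. *)
Section FixedPoint.
Variables (m : nat) (F : 'rV[R]_m -> 'rV[R]_m) (y0 : 'rV[R]_m) (t0 K r : R).
Hypotheses (K0 : 0 <= K) (r0 : 0 < r).
Hypothesis lipF : forall x y : 'rV[R]_m, `|x - y0| < r -> `|y - y0| < r ->
  `|F x - F y| <= K * `|x - y|.

Let M := `|F y0| + K * r.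
(* [a * M <= r / 2] keeps the iterates in the ball of radius [r / 2], and
   [a * K <= 1 / 2] makes the iteration halve distances. *)
Let a := Num.min (r / 2 / (M + 1)) (1 / 2 / (K + 1)).

Let M0 : 0 <= M.
Proof. by rewrite addr_ge0// mulr_ge0// ltW. Qed.

Let a0 : 0 < a.
Proof.
have ? := K0; have ? := r0; have ? := M0.
by rewrite lt_min !divr_gt0// ltr_wpDl.
Qed.

Let aM : a * M <= r / 2.
Proof.
have M1 : 0 < M + 1 by rewrite ltr_wpDl.
have : a <= r / 2 / (M + 1) by rewrite /a ge_min lexx.
by rewrite ler_pdivlMr//; apply: le_trans; rewrite ler_pM2l// lerDl.
Qed.

Let aK : a * K <= 1 / 2.
Proof.
have K1 : 0 < K + 1 by rewrite ltr_wpDl.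
have : a <= 1 / 2 / (K + 1) by rewrite /a ge_min lexx orbT.
by rewrite ler_pdivlMr//; apply: le_trans; rewrite ler_pM2l// lerDl.
Qed.

Let F_bound x : `|x - y0| < r -> `|F x| <= M.
Proof.
move=> xr; rewrite -(subrK (F y0) (F x)) addrC.
apply: le_trans (ler_normD _ _) _; rewrite lerD2l.
apply: le_trans (lipF xr _) _; first by rewrite subrr normr0.
by rewrite ler_wpM2l// ltW.
Qed.

Let F_continuous x : `|x - y0| < r -> {for x, continuous F}.
Proof. exact: (lipschitz_continuous K0 lipF). Qed.

(* Stopping the time at distance [a] from [t0] makes the iterates continuous
   and bounded on the whole line. *)
Let clamp (t : R) : R := Num.max (t0 - a) (Num.min t (t0 + a)).

Let clamp_continuous : continuous clamp.
Proof.
move=> t; apply: (@continuous_max _ _ (cst (t0 - a)) (id \min cst (t0 + a))).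
  exact: cst_continuous.
by apply: (@continuous_min _ _ id (cst (t0 + a))) => //; exact: cst_continuous.
Qed.

Let clamp_dist t : `|clamp t - t0| <= a.
Proof.
have ? := a0.
have h1 : t0 - a <= clamp t by rewrite /clamp le_max lexx.
have h2 : clamp t <= t0 + a by rewrite /clamp ge_max ge_min lexx orbT andbT; lra.
rewrite ler_norml; lra.
Qed.

Let clamp_id t : `|t - t0| <= a -> clamp t = t.
Proof.
rewrite ler_norml => /andP[t1 t2]; rewrite /clamp min_l ?max_r//; lra.
Qed.

(* The primitives are taken on the double interval, so that they are
   differentiable up to the distance [a] included. *)
Let Phi (w : R -> 'rV[R]_m) (t : R) : 'rV[R]_m :=
  y0 + \row_i primitive t0 (a *+ 2) (fun s => F (w s) ord0 i) (clamp t).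

Let admissible (w : R -> 'rV[R]_m) :=
  continuous w /\ forall t, `|w t - y0| <= r / 2.

Let in_ball w t : admissible w -> `|w t - y0| < r.
Proof. by move=> [_ /(_ t)] /le_lt_trans; apply; have := r0; lra. Qed.

Let Fw_continuous w i : admissible w -> continuous (fun s => F (w s) ord0 i).
Proof.
move=> aw s; apply: continuous_entry; apply: continuous_comp; first exact: aw.1.
by apply: F_continuous; exact: in_ball.
Qed.

Let clamp_in t : `|clamp t - t0| < a *+ 2.
Proof. by apply: le_lt_trans (clamp_dist t) _; have := a0; rewrite mulr2n; lra. Qed.

Let Phi_admissible w : admissible w -> admissible (Phi w).
Proof.
move=> aw; split.
  move=> t; apply: continuous_rV => i.
  have -> : (fun x => Phi w x ord0 i) = cst (y0 ord0 i) \+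
      (primitive t0 (a *+ 2) (fun s => F (w s) ord0 i) \o clamp).
    by apply/funext => x; rewrite /Phi !mxE.
  apply: continuousD; first exact: cst_continuous.
  apply: (@continuous_comp _ _ _ clamp (primitive _ _ _)); first exact: clamp_continuous.
  apply/differentiable_continuous/derivable1_diffP.
  by have [] := is_derive_primitive (@Fw_continuous w i aw) (clamp_in t).
move=> t; rewrite /Phi addrAC subrr add0r; apply: rV_norm_le.
  by rewrite divr_ge0// ltW.
move=> i; rewrite mxE -[primitive _ _ _ _]subr0.
rewrite -(primitive0 t0 (a *+ 2) (fun s => F (w s) ord0 i)).
apply: le_trans; last exact: aM.
apply: le_trans (mean_value_bound (d := M) _ _ (clamp_in t)) _.
- by move=> s sb; apply: is_derive_primitive sb; exact: Fw_continuous.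
- by move=> s _; apply: le_trans (rV_norm_coord _ _) _; apply: F_bound; exact: in_ball.
- by rewrite ler_wpM2r.
Qed.

Let Phi_contract w w' d : admissible w -> admissible w' ->
  (forall t, `|w t - w' t| <= d) -> forall t, `|Phi w t - Phi w' t| <= d / 2.
Proof.
move=> aw aw' ww' t.
have d0 : 0 <= d by apply: le_trans (ww' t).
apply: rV_norm_le; first by rewrite divr_ge0.
move=> i; rewrite !mxE [X in `|X|](_ : _ =
  (primitive t0 (a *+ 2) (fun s => F (w s) ord0 i)
  - primitive t0 (a *+ 2) (fun s => F (w' s) ord0 i)) (clamp t) -
  (primitive t0 (a *+ 2) (fun s => F (w s) ord0 i)
  - primitive t0 (a *+ 2) (fun s => F (w' s) ord0 i)) t0); last first.
  by rewrite !fctE !primitive0; ring.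
apply: le_trans (mean_value_bound (d := K * d)
   (df := fun s => F (w s) ord0 i - F (w' s) ord0 i) _ _ (clamp_in t)) _.
- move=> s sb; apply: is_deriveB.
    by apply: is_derive_primitive sb; exact: Fw_continuous.
  by apply: is_derive_primitive sb; exact: Fw_continuous.
- move=> s _; have := rV_norm_coord (F (w s) - F (w' s)) i.
  rewrite !mxE => /le_trans; apply.
  apply: le_trans (lipF (in_ball s aw) (in_ball s aw')) _.
  by rewrite ler_wpM2l.
apply: (@le_trans _ _ (a * (K * d))).
  by rewrite ler_wpM2r// mulr_ge0.
by rewrite mulrA [leRHS]mulrC -[_^-1]mul1r ler_wpM2r.
Qed.

Let W k := iter k Phi (cst y0).

Let W_admissible k : admissible (W k).
Proof.
elim: k => [|k IH]; last exact: Phi_admissible.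
split=> [t|t]; first exact: cst_continuous.
by rewrite subrr normr0 divr_ge0// ltW.
Qed.

Let W_step k t : `|W k.+1 t - W k t| <= r / 2 ^+ k.
Proof.
elim: k t => [|k IH] t.
  rewrite expr0 divr1; apply: le_trans ((W_admissible 1).2 t) _.
  by have := r0; lra.
rewrite exprSr invfM mulrA.
exact: (Phi_contract (W_admissible _) (W_admissible _) IH).
Qed.

Let fixed_point : exists w, admissible w /\ Phi w = w.
Proof.
have /choice[w Hw] t : exists l, forall k, `|l - W k t| <= r *+ 2 / 2 ^+ k.
  by apply: geometric_limit_rV; [exact: ltW|move=> k; exact: W_step].
have aw : admissible w.
  split=> t; last first.
    rewrite -subr_le0; apply: (@le_geometric _ (r *+ 2)) => k.
    rewrite lerBlDr; apply: le_trans (ler_distD (W k t) _ _) _.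
    by apply: lerD; [exact: Hw|exact: (W_admissible k).2].
  apply/cvgrPdist_le => e e0.
  have [k Hk] : exists k : nat, r *+ 2 / 2 ^+ k <= e / 4.
    apply: contrapT => /forallNP H.
    suff : e / 4 <= 0 by apply/negP; rewrite -ltNge divr_gt0.
    apply: (@le_geometric _ (r *+ 2)) => k.
    by have /negP := H k; rewrite -ltNge => /ltW.
  have e20 : 0 < e / 2 by rewrite divr_gt0.
  have /cvgrPdist_le/(_ _ e20) := (W_admissible k).1 t.
  apply: filterS => s Hs.
  apply: le_trans (ler_distD (W k t) _ _) _.
  apply: (@le_trans _ _ (e / 4 + (e / 2 + e / 4))); last by lra.
  apply: lerD; first exact: le_trans (Hw t k) Hk.
  apply: le_trans (ler_distD (W k s) _ _) _.
  by apply: lerD; [exact: Hs|rewrite distrC; exact: le_trans (Hw s k) Hk].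
exists w; split=> //; apply/funext => t; apply/eqP; rewrite -subr_eq0 -normr_le0.
apply: (@le_geometric _ (r *+ 2)) => k.
apply: le_trans (ler_distD (W k.+1 t) _ _) _.
have -> : r *+ 2 / 2 ^+ k = r *+ 2 / 2 ^+ k / 2 + r *+ 2 / 2 ^+ k / 2 by lra.
apply: lerD; first exact: (Phi_contract aw (W_admissible k) (fun t => Hw t k)).
by rewrite distrC -mulrA -invfM -exprSr; exact: Hw.
Qed.

Lemma picard_lindelof_lip : exists2 b, 0 < b & exists y : R -> 'rV[R]_m,
  [/\ y t0 = y0, forall t, `|t - t0| < b -> `|y t - y0| < r &
      forall t, `|t - t0| < b -> is_derive t (1 : R) y (F (y t))].
Proof.
have [w [aw Pw]] := fixed_point; exists a; first exact: a0; exists w; split.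
- rewrite -Pw /Phi clamp_id ?subrr ?normr0 ?(ltW a0)//.
  by apply/rowP => i; rewrite !mxE primitive0 addr0.
- by move=> t _; exact: in_ball.
move=> t ta.
have nw : \forall s \near t,
    y0 + \row_i primitive t0 (a *+ 2) (fun s => F (w s) ord0 i) s = w s.
  have : \forall s \near t, `|t - s| < a - `|t - t0|.
    by apply: nbhs_dist_lt; rewrite subr_gt0.
  apply: filterS => s ts; rewrite -[RHS](congr1 (fun f => f s) Pw) /Phi clamp_id//.
  have -> : s - t0 = (t - t0) - (t - s) by ring.
  apply: le_trans (ler_normB _ _) _; lra.
apply: near_eq_is_derive nw _.
have ta2 : `|t - t0| < a *+ 2 by apply: lt_trans ta _; have := a0; rewrite mulr2n; lra.
have dP i := is_derive_primitive (@Fw_continuous w i aw) ta2.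
have dQ i : is_derive t (1 : R) (fun x => (y0 +
    \row_j primitive t0 (a *+ 2) (fun s => F (w s) ord0 j) x) ord0 i) (F (w t) ord0 i).
  rewrite [X in is_derive _ _ X](_ : _ = cst (y0 ord0 i) +
      primitive t0 (a *+ 2) (fun s => F (w s) ord0 i)); last first.
    by apply/funext => x; rewrite !mxE.
  apply: is_derive_eq (is_deriveD (is_derive_cst (y0 ord0 i) _ _) (dP i)) _.
  by rewrite add0r.
exact: is_derive_rV.
Qed.

End FixedPoint.

End Picard.

(** * Calculus of locally Lipschitz functions *)

Section LocallyLipschitz.
Variables (R : realType) (V : normedModType R) (x0 : V).
Implicit Types f g : V -> R.

Lemma lip_at_cst (c : R) : lip_at (fun=> c) x0.
Proof. by exists 0, 1; split=> // x y _ _; rewrite subrr normr0 mul0r. Qed.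

Lemma lip_atD f g : lip_at f x0 -> lip_at g x0 -> lip_at (fun x => f x + g x) x0.
Proof.
move=> [K [r [K0 r0 lf]]] [L [s [L0 s0 lg]]].
exists (K + L), (Num.min r s); split; first exact: addr_ge0.
  by rewrite lt_min r0.
move=> x y; rewrite !lt_min => /andP[xr xs] /andP[yr ys].
rewrite opprD addrACA mulrDl; apply: le_trans (ler_normD _ _) _.
by apply: lerD; [exact: lf|exact: lg].
Qed.

(** A common constant for the Lipschitz bound and the bound on the values makes
    the product rule immediate. *)
Lemma lip_at_bounded f : lip_at f x0 ->
  exists K r, [/\ 0 <= K, 0 < r, forall x y, `|x - x0| < r -> `|y - x0| < r ->
    `|f x - f y| <= K * `|x - y| & forall x, `|x - x0| < r -> `|f x| <= K].
Proof.
move=> [K [r [K0 r0 lf]]]; have rf : 0 <= `|f x0| + K * r.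
  by rewrite addr_ge0// mulr_ge0// ltW.
exists (K + (`|f x0| + K * r)), r; split=> [||x y xr yr|x xr] //.
- exact: addr_ge0.
- by apply: le_trans (lf _ _ xr yr) _; rewrite ler_wpM2r// lerDl.
rewrite -[leLHS]add0r; apply: lerD => //.
rewrite -(subrK (f x0) (f x)) addrC; apply: le_trans (ler_normD _ _) _.
rewrite lerD2l; apply: le_trans (lf _ _ xr _) _; first by rewrite subrr normr0.
by rewrite ler_wpM2l// ltW.
Qed.

Lemma lip_atM f g : lip_at f x0 -> lip_at g x0 -> lip_at (fun x => f x * g x) x0.
Proof.
move=> /lip_at_bounded[K [r [K0 r0 lf bf]]] /lip_at_bounded[L [s [L0 s0 lg bg]]].
exists (K * L + K * L), (Num.min r s); split; first by rewrite addr_ge0// mulr_ge0.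
  by rewrite lt_min r0.
move=> x y; rewrite !lt_min => /andP[xr xs] /andP[yr ys].
have -> : f x * g x - f y * g y = f x * (g x - g y) + (f x - f y) * g y by ring.
rewrite [leRHS]mulrDl; apply: le_trans (ler_normD _ _) _; rewrite !normrM; apply: lerD.
  by rewrite -mulrA ler_pM//; [exact: bf|exact: lg].
by rewrite mulrAC ler_pM//; [exact: lf|exact: bg].
Qed.

Lemma lip_atN f : lip_at f x0 -> lip_at (fun x => - f x) x0.
Proof.
move=> [K [r [K0 r0 lf]]]; exists K, r; split=> // x y xr yr.
by rewrite -opprD normrN; exact: lf.
Qed.

Lemma lip_atV f : lip_at f x0 -> f x0 != 0 -> lip_at (fun x => (f x)^-1) x0.
Proof.
move=> [K [r [K0 r0 lf]]] f0; have d0 : 0 < `|f x0| by rewrite normr_gt0.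
(* Near [x0] the values of [f] stay above half of the value at [x0]. *)
pose d := `|f x0| / 2; have dgt0 : 0 < d by rewrite divr_gt0.
exists (K / (d * d)), (Num.min r (d / (K + 1))); have K1 : 0 < K + 1 by rewrite ltr_wpDl.
have low x : `|x - x0| < Num.min r (d / (K + 1)) -> d <= `|f x|.
  rewrite lt_min => /andP[xr xd].
  have : `|f x - f x0| <= d.
    apply: le_trans (lf _ _ xr _) _; first by rewrite subrr normr0.
    apply: (@le_trans _ _ ((K + 1) * `|x - x0|)); first by rewrite ler_wpM2r// lerDl.
    by rewrite mulrC -ler_pdivlMr// ltW.
  have := ler_normD (f x0 - f x) (f x); rewrite subrK distrC /d; lra.
split; first by rewrite divr_ge0// mulr_ge0// ltW.
  by rewrite lt_min r0 divr_gt0.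
move=> x y xr yr; have fx := low _ xr; have fy := low _ yr.
move: xr yr; rewrite !lt_min => /andP[xr _] /andP[yr _].
have fx0 : f x != 0 by rewrite -normr_gt0 (lt_le_trans dgt0).
have fy0 : f y != 0 by rewrite -normr_gt0 (lt_le_trans dgt0).
have -> : (f x)^-1 - (f y)^-1 = - (f x - f y) / (f x * f y) by field; rewrite ?fx0 ?fy0.
rewrite normrM normrN normfV mulrAC.
have dd : d * d <= `|f x * f y| by rewrite normrM ler_pM// ltW.
have dd0 : 0 < d * d by rewrite mulr_gt0.
apply: ler_pM; [by []|by rewrite invr_ge0|exact: lf|].
by rewrite lef_pV2 ?posrE// (lt_le_trans dd0).
Qed.

Lemma lip_at_sum (I : Type) (s : seq I) (f : I -> V -> R) :
  (forall i, lip_at (f i) x0) -> lip_at (fun x => \sum_(i <- s) f i x) x0.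
Proof.
move=> lf; elim: s => [|i s IH].
  by under eq_fun do rewrite big_nil; exact: lip_at_cst.
by under eq_fun do rewrite big_cons; exact: lip_atD.
Qed.

Lemma lip_at_prod (I : Type) (s : seq I) (f : I -> V -> R) :
  (forall i, lip_at (f i) x0) -> lip_at (fun x => \prod_(i <- s) f i x) x0.
Proof.
move=> lf; elim: s => [|i s IH].
  by under eq_fun do rewrite big_nil; exact: lip_at_cst.
by under eq_fun do rewrite big_cons; exact: lip_atM.
Qed.

Definition lip_mx p q (M : V -> 'M[R]_(p, q)) :=
  forall i j, lip_at (fun x => M x i j) x0.

Lemma lip_at_det n (M : V -> 'M[R]_n) : lip_mx M -> lip_at (fun x => \det (M x)) x0.
Proof.
move=> lM; apply: lip_at_sum => s; apply: lip_atM; first exact: lip_at_cst.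
by apply: lip_at_prod => i; exact: lM.
Qed.

Lemma lip_mxM p q s (M : V -> 'M[R]_(p, q)) (N : V -> 'M[R]_(q, s)) :
  lip_mx M -> lip_mx N -> lip_mx (fun x => M x *m N x).
Proof.
move=> lM lN i j; under eq_fun do rewrite mxE.
by apply: lip_at_sum => k; apply: lip_atM; [exact: lM|exact: lN].
Qed.

Lemma lip_mxZ p q (c : V -> R) (M : V -> 'M[R]_(p, q)) :
  lip_at c x0 -> lip_mx M -> lip_mx (fun x => c x *: M x).
Proof. by move=> lc lM i j; under eq_fun do rewrite mxE; exact: lip_atM. Qed.

Lemma lip_mxB p q (M N : V -> 'M[R]_(p, q)) :
  lip_mx M -> lip_mx N -> lip_mx (fun x => M x - N x).
Proof.
move=> lM lN i j; under eq_fun do rewrite !mxE.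
by apply: lip_atD => //; exact: lip_atN.
Qed.

Lemma lip_mx_sum p q (I : finType) (M : I -> V -> 'M[R]_(p, q)) :
  (forall k, lip_mx (M k)) -> lip_mx (fun x => \sum_k M k x).
Proof.
by move=> lM i j; under eq_fun do rewrite summxE; apply: lip_at_sum => k; exact: lM.
Qed.

Lemma lip_mx_adj n (M : V -> 'M[R]_n) : lip_mx M -> lip_mx (fun x => \adj (M x)).
Proof.
move=> lM i j; under eq_fun do rewrite mxE.
apply: lip_atM; first exact: lip_at_cst.
apply: lip_at_det => k l; under eq_fun do rewrite !mxE; exact: lM.
Qed.

Lemma lip_at_rV m (f : V -> 'rV[R]_m) : lip_mx f -> lip_at f x0.
Proof.
move=> lf.
have /choice[K /choice[r Hr]] := lf ord0.
pose L := \sum_i K i; pose d := \big[Num.min/1]_i r i.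
exists L, d; have KL i : K i <= L.
  rewrite /L (bigD1 i)//= lerDl; apply: sumr_ge0 => j _; by have [] := Hr j.
have dr i : d <= r i by exact: bigmin_le.
have L0 : 0 <= L by apply: sumr_ge0 => j _; have [] := Hr j.
split=> //.
  by rewrite lt_bigmin// => i _; have [] := Hr i.
move=> x y xd yd; apply: rV_norm_le; first exact: mulr_ge0.
move=> i; rewrite !mxE; have [_ _ Hi] := Hr i.
apply: le_trans (Hi _ _ (lt_le_trans xd (dr i)) (lt_le_trans yd (dr i))) _.
by rewrite ler_wpM2r.
Qed.

End LocallyLipschitz.

Lemma lip_at_comp_nonexpansive (R : realType)
    (V W : normedModType R) (h : V -> W) (f : W -> R) x0 :
  (forall x y, `|h x - h y| <= `|x - y|) -> lip_at f (h x0) -> lip_at (f \o h) x0.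
Proof.
move=> h1 [K [r [K0 r0 lf]]]; exists K, r; split=> // x y xr yr.
apply: le_trans (lf _ _ (le_lt_trans (h1 _ _) xr) (le_lt_trans (h1 _ _) yr)) _.
by rewrite ler_wpM2l.
Qed.

Section Submx.
Variables (R : realType) (p q : nat).
Lemma lsubmx_dist (x y : 'rV[R]_(p + q)) : `|lsubmx x - lsubmx y| <= `|x - y|.
Proof.
apply: rV_norm_le => // i; have := rV_norm_coord (x - y) (lshift q i).
by rewrite !mxE.
Qed.
Lemma rsubmx_dist (x y : 'rV[R]_(p + q)) : `|rsubmx x - rsubmx y| <= `|x - y|.
Proof.
apply: rV_norm_le => // i; have := rV_norm_coord (x - y) (rshift p i).
by rewrite !mxE.
Qed.
End Submx.

(** * The Euler-Lagrange covector and geodesics *)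

Section EulerLagrange.
Variables (R : realType) (n : nat).
Implicit Types (G : 'M[R]_n) (dG : 'I_n -> 'M[R]_n) (V A : 'rV[R]_n).

(** In terms of the metric [G] and its partial derivatives [dG j], the part of
    the Euler-Lagrange expression of the energy which is quadratic in the
    velocity [V]: it comes from differentiating the momentum [V *m G] along the
    curve and subtracting half of the derivative of the squared speed
    [V *m G *m V^T] in the space variables. *)
Definition el_force dG V : 'rV[R]_n :=
  \sum_j V ord0 j *: (V *m dG j) - 2^-1 *: \row_a (V *m dG a *m V^T) ord0 ord0.

(** Its vanishing is the geodesic equation with the index lowered. This form is
    preferred to the one with Christoffel symbols because it transforms as a
    covector. *)
Definition euler_lagrange G dG V A : 'rV[R]_n := A *m G + el_force dG V.

Definition partial_mx m (g : 'rV[R]_m -> 'M[R]_n) (x : 'rV[R]_m) (j : 'I_m) : 'M[R]_n :=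
  \matrix_(a, b) partial j (fun w => g w a b : R) x.

(** The hypotheses say that [g] is the pullback of [G] by a map with Jacobian
    matrix [J]; the last two arguments on the right are the velocity and the
    acceleration of the image curve. All terms with derivatives of [J] cancel:
    those from the acceleration match those from the derivative of the momentum,
    and the symmetry of second derivatives [sJ] equates the remaining two. *)
Lemma euler_lagrange_covariant G dG g dg (J : 'M[R]_n) (dJ : 'I_n -> 'M[R]_n) V A :
  G^T = G -> g = J *m G *m J^T ->
  (forall a, dg a = dJ a *m G *m J^T + J *m (\sum_r J a r *: dG r) *m J^T
                    + J *m G *m (dJ a)^T) ->
  (forall a k s, dJ a k s = dJ k a s) ->
  euler_lagrange g dg V A =
  euler_lagrange G dG (V *m J) (A *m J + \sum_j V ord0 j *: (V *m dJ j)) *m J^T.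
Proof.
move=> sG -> dgE sJ; set W := V *m J.
have claim1 : \sum_j V ord0 j *: (V *m dg j) =
    (\sum_j V ord0 j *: (V *m dJ j)) *m G *m J^T
    + (\sum_r W ord0 r *: (W *m dG r)) *m J^T
    + \sum_j V ord0 j *: (W *m G *m (dJ j)^T).
  have -> : \sum_r W ord0 r *: (W *m dG r) =
      \sum_j V ord0 j *: (W *m \sum_r J j r *: dG r).
    under eq_bigr do rewrite mxE scaler_suml.
    rewrite exchange_big; apply: eq_bigr => j _ /=.
    rewrite mulmx_sumr scaler_sumr; apply: eq_bigr => r _.
    by rewrite -scalemxAr scalerA.
  rewrite !mulmx_suml -!big_split /=; apply: eq_bigr => j _.
  by rewrite dgE !mulmxDr !scalerDr -!scalemxAl !mulmxA.
have claim2 a : (V *m dg a *m V^T) ord0 ord0 =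
    (\row_r (W *m dG r *m W^T) ord0 ord0 *m J^T) ord0 a
    + (\sum_j V ord0 j *: (W *m G *m (dJ j)^T)) ord0 a *+ 2.
  have E1 : (V *m (dJ a *m G *m J^T) *m V^T) ord0 ord0 =
      (V *m (J *m G *m (dJ a)^T) *m V^T) ord0 ord0.
    have -> : V *m (dJ a *m G *m J^T) *m V^T = (V *m (J *m G *m (dJ a)^T) *m V^T)^T.
      by rewrite !trmx_mul !trmxK sG !mulmxA.
    by rewrite mxE.
  have E2 : (V *m (J *m (\sum_r J a r *: dG r) *m J^T) *m V^T) ord0 ord0 =
      (\row_r (W *m dG r *m W^T) ord0 ord0 *m J^T) ord0 a.
    rewrite !mulmxA -/W -mulmxA -trmx_mul -/W mulmx_sumr mulmx_suml summxE mxE.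
    by apply: eq_bigr => r _; rewrite -scalemxAr -scalemxAl !mxE mulrC.
  have E3 : (V *m (J *m G *m (dJ a)^T) *m V^T) ord0 ord0 =
      (\sum_j V ord0 j *: (W *m G *m (dJ j)^T)) ord0 a.
    rewrite !mulmxA -/W -mulmxA -trmx_mul mxE summxE.
    under eq_bigr do rewrite !mxE mulr_sumr.
    under [RHS]eq_bigr do rewrite !mxE mulr_sumr.
    rewrite exchange_big; apply: eq_bigr => j _; apply: eq_bigr => s _.
    by rewrite [(W *m G) _ _]mxE [_^T _ _]mxE -(sJ a) mulrCA.
  rewrite dgE 2!mulmxDr 2!mulmxDl [LHS]mxE [X in X + _ = _]mxE E1 E2 E3.
  by rewrite mulr2n addrAC addrC.
rewrite /euler_lagrange /el_force claim1.
rewrite !mulmxDl !mulmxA -/W !mulNmx -scalemxAl -!addrA.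
congr (_ + _); congr (_ + _); congr (_ + _).
apply/rowP => a; rewrite [LHS]mxE [X in _ + X = _]mxE [X in _ - X = _]mxE.
rewrite [X in _ - _ * X = _]mxE claim2 [RHS]mxE [X in _ = - X]mxE; lra.
Qed.

End EulerLagrange.

Section Geodesic.
Variables (R : realType) (n : nat) (g : 'rV[R]_n -> 'M[R]_n) (B : set 'rV[R]_n).
Hypotheses (oB : open B) (Cg : Ck 2 B g) (detg : forall x, B x -> \det (g x) != 0).

(* The adjugate matrix divided by the determinant is used for the inverse of
   the metric, because it is a rational function of the entries. *)
Let geoF (y : 'rV[R]_(n + n)) : 'rV[R]_(n + n) :=
  row_mx (rsubmx y) ((- (\det (g (lsubmx y)))^-1) *:
    (el_force (partial_mx g (lsubmx y)) (rsubmx y) *m \adj (g (lsubmx y)))).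

Let lip_geoF p v : B p -> lip_at geoF (row_mx p v).
Proof.
move=> Bp; set y0 := row_mx p v.
have lg a b : lip_at (fun y : 'rV[R]_(n + n) => g (lsubmx y) a b) y0.
  apply: (@lip_at_comp_nonexpansive _ _ _ lsubmx (fun x => g x a b)).
    exact: lsubmx_dist.
  rewrite row_mxKl; apply: (Ck1_lip_at oB _ Bp).
  exact: (@CkW _ _ _ 1 _ _ (Ck_entry a b oB Cg)).
have ldg a b j : lip_at (fun y : 'rV[R]_(n + n) => partial_mx g (lsubmx y) j a b) y0.
  under eq_fun do rewrite mxE.
  apply: (@lip_at_comp_nonexpansive _ _ _ lsubmx 
    (fun x => partial j (fun w => g w a b : R) x)); first exact: lsubmx_dist.
  rewrite row_mxKl; apply: (Ck1_lip_at oB _ Bp).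
  exact: ((Ck_entry a b oB Cg).2 j).
have lv i j : lip_at (fun y : 'rV[R]_(n + n) => rsubmx y i j) y0.
  exists 1, 1; split=> // x y _ _; rewrite mul1r ord1.
  have := rV_norm_coord (rsubmx x - rsubmx y) j.
  rewrite [X in `|X| <= _]mxE [X in _ + X]mxE => /le_trans; apply.
  exact: rsubmx_dist.
have lvT : lip_mx y0 (fun y : 'rV[R]_(n + n) => (rsubmx y)^T).
  by move=> i j; under eq_fun do rewrite mxE; exact: lv.
suff lacc : lip_mx y0 (fun y => (- (\det (g (lsubmx y)))^-1) *:
    (el_force (partial_mx g (lsubmx y)) (rsubmx y) *m \adj (g (lsubmx y)))).
  apply: lip_at_rV => i j; rewrite -(splitK j); case: (fintype.split j) => k /=.
    under eq_fun do rewrite /geoF row_mxEl; exact: lv.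
  under eq_fun do rewrite /geoF row_mxEr; exact: lacc.
apply: lip_mxZ.
  by apply: lip_atN; apply: lip_atV; [exact: lip_at_det|rewrite row_mxKl; exact: detg].
apply: lip_mxM; last exact: lip_mx_adj.
apply: lip_mxB.
  apply: lip_mx_sum => l; apply: lip_mxZ; first exact: lv.
  by apply: lip_mxM => a b; [exact: lv|exact: ldg].
apply: lip_mxZ; first exact: lip_at_cst.
move=> a b; under eq_fun do rewrite mxE.
have lq : lip_mx y0 (fun y => rsubmx y *m partial_mx g (lsubmx y) b *m (rsubmx y)^T).
  by apply: lip_mxM => //; apply: lip_mxM => // c d; exact: ldg.
exact: lq.
Qed.

(** The geodesic equation is solved as a first-order system for the position
    and the velocity. The acceleration is a rational expression in the metric,
    its first derivatives and the velocity, and these are all locally Lipschitz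
    because the metric is of class C^2. *)
Lemma geodesic_exists p v t0 : B p ->
  exists2 b, 0 < b & exists x x1 x2 : R -> 'rV[R]_n,
    [/\ x t0 = p, x1 t0 = v & forall t, `|t - t0| < b ->
     [/\ B (x t), is_derive t (1 : R) x (x1 t), is_derive t (1 : R) x1 (x2 t),
         {for t, continuous x2} &
         euler_lagrange (g (x t)) (partial_mx g (x t)) (x1 t) (x2 t) = 0]].
Proof.
move=> Bp; have [K [r [K0 r0 lF]]] := lip_geoF v Bp.
have [d d0 dB] := nbhs_dist (open_nbhs_nbhs (conj oB Bp)).
pose r' := Num.min r d.
have r'0 : 0 < r' by rewrite lt_min r0.
have lF' x y : `|x - row_mx p v| < r' -> `|y - row_mx p v| < r' ->
    `|geoF x - geoF y| <= K * `|x - y|.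
  by rewrite !lt_min => /andP[xr _] /andP[yr _]; exact: lF.
have [b b0 [y [y0 yr dy]]] := picard_lindelof_lip t0 K0 r'0 lF'.
exists b => //; exists (lsubmx \o y), (rsubmx \o y), (rsubmx \o geoF \o y).
split; [by rewrite /= y0 row_mxKl|by rewrite /= y0 row_mxKr|move=> t tb].
have Bt : B (lsubmx (y t)).
  apply: dB; rewrite -[X in _ - X](row_mxKl p v).
  by apply: le_lt_trans (lsubmx_dist _ _) _; have := yr _ tb; rewrite lt_min => /andP[].
have dyi i := is_derive_coord i (dy t tb).
split.
- exact: Bt.
- apply: is_derive_rV => i.
  have -> : (fun s => (lsubmx \o y) s ord0 i) = (fun s => y s ord0 (lshift n i)).
    by apply/funext => s; rewrite /= mxE.
  by apply: is_derive_eq (dyi _) _; rewrite row_mxEl.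
- apply: is_derive_rV => i.
  have -> : (fun s => (rsubmx \o y) s ord0 i) = (fun s => y s ord0 (rshift n i)).
    by apply/funext => s; rewrite /= mxE.
  by apply: is_derive_eq (dyi _) _; rewrite [RHS]mxE.
- have cy : {for t, continuous y}.
    by have [? _] := dy t tb; exact/differentiable_continuous/derivable1_diffP.
  apply: continuous_comp; first exact: cy.
  apply: continuous_comp; last exact: continuous_rsubmx.
  exact: (lipschitz_continuous K0 lF' (yr _ tb)).
rewrite /euler_lagrange /= row_mxKr -scalemxAl -mulmxA mul_adj_mx.
rewrite mul_mx_scalar scalerA mulNr mulVf ?detg//.
by rewrite scaleN1r addNr.
Qed.

End Geodesic.

(** * Curves and metrics under a change of coordinates *)

Section MatrixDerivative.
Variables (R : realType) (V : normedModType R).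

Lemma is_derive_bigsum n (f : 'I_n -> V -> R) (df : 'I_n -> R) u v :
  (forall i, is_derive u v (f i) (df i)) ->
  is_derive u v (fun x => \sum_i f i x) (\sum_i df i).
Proof.
by move=> H; rewrite -fct_sumE; exact: is_derive_sum.
Qed.

Lemma continuous_bigsum (T : topologicalType) n (f : 'I_n -> T -> R) u :
  (forall i, {for u, continuous (f i)}) ->
  {for u, continuous (fun x => \sum_i f i x)}.
Proof.
move=> H; elim: (index_enum _) => [|i s IH].
  have -> : (fun x => \sum_(i <- [::]) f i x) = cst 0.
    by apply/funext => x; rewrite big_nil.
  exact: cst_continuous.
have -> : (fun x => \sum_(j <- i :: s) f j x) = f i \+ (fun x => \sum_(j <- s) f j x).
  by apply/funext => x; rewrite big_cons.
by apply: continuousD; [exact: H|exact: IH].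
Qed.

(** Entrywise, so that no normed structure on the matrices is involved. *)
Definition is_mderive p q (M : V -> 'M[R]_(p, q)) u v (dM : 'M[R]_(p, q)) :=
  forall i j, is_derive u v (fun x => M x i j : R) (dM i j).

Lemma is_mderiveM p q s (M : V -> 'M[R]_(p, q)) (N : V -> 'M[R]_(q, s)) u v dM dN :
  is_mderive M u v dM -> is_mderive N u v dN ->
  is_mderive (fun x => M x *m N x) u v (dM *m N u + M u *m dN).
Proof.
move=> HM HN i j.
have -> : (fun x => (M x *m N x) i j) = (fun x => \sum_k M x i k * N x k j).
  by apply/funext => x; rewrite mxE.
rewrite !mxE -big_split /=; apply: is_derive_bigsum => k.
apply: is_derive_eq (is_deriveM (HM i k) (HN k j)) _.
by rewrite addrC /GRing.scale /= [N u k j * _]mulrC.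
Qed.

Lemma is_mderive_tr p q (M : V -> 'M[R]_(p, q)) u v dM :
  is_mderive M u v dM -> is_mderive (fun x => (M x)^T) u v dM^T.
Proof.
move=> HM i j; rewrite mxE.
have -> : (fun x => (M x)^T i j) = (fun x => M x j i).
  by apply/funext => x; rewrite mxE.
exact: HM.
Qed.

End MatrixDerivative.

Section Transformation.
Variables (R : realType) (n : nat) (T : 'rV[R]_n -> 'rV[R]_n) (B : set 'rV[R]_n).
Hypotheses (oB : open B) (CT : Ck 2 B T).

(** Unlike ['J T], its entries are partial derivatives of scalar functions also
    where [T] is not differentiable, so that they can be differentiated again
    without side conditions. *)
Definition jac_mx (y : 'rV[R]_n) : 'M[R]_n :=
  \matrix_(a, m) partial a (fun w => T w ord0 m) y.

Let CTm m : Ck 2 B (fun w => T w ord0 m).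
Proof. exact: Ck_entry. Qed.

Lemma jacobian_jac_mx y : B y -> 'J T y = jac_mx y.
Proof.
move=> By; apply/matrixP => a m; rewrite !mxE -(partial_coord _ _ (CT.1 _ By)).
by rewrite /partial deriveE//; exact: CT.1.
Qed.

Lemma partial_mx_jac_mx y a k m : B y -> partial_mx jac_mx y a k m =
  partial a (partial k (fun w => T w ord0 m)) y.
Proof.
move=> By; rewrite mxE; congr (partial a _ y).
by apply/funext => w; rewrite mxE.
Qed.

Lemma is_mderive_jac_mx y a : B y ->
  is_mderive jac_mx y (delta_mx ord0 a) (partial_mx jac_mx y a).
Proof.
move=> By i j; rewrite partial_mx_jac_mx//.
have -> : (fun w => jac_mx w i j) = partial i (fun w => T w ord0 j).
  by apply/funext => w; rewrite mxE.
apply: derivableP; apply: diff_derivable; exact: ((CTm j).2 i).1.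
Qed.

Section Curve.
Variables (x x1 x2 : R -> 'rV[R]_n).

Definition push_velocity t : 'rV[R]_n := x1 t *m jac_mx (x t).

Definition push_acceleration t : 'rV[R]_n := x2 t *m jac_mx (x t) +
  \sum_j x1 t ord0 j *: (x1 t *m partial_mx jac_mx (x t) j).

Variable t : R.
Hypotheses (Bt : B (x t)) (dx : is_derive t (1 : R) x (x1 t))
  (dx1 : is_derive t (1 : R) x1 (x2 t)) (cx2 : {for t, continuous x2}).

Let dfx : differentiable x t.
Proof. by case: dx => dx' _; exact/derivable1_diffP. Qed.

Let chain_x (f : 'rV[R]_n -> R) : differentiable f (x t) ->
  is_derive t (1 : R) (fun s => f (x s)) (\sum_j x1 t ord0 j * partial j f (x t)).
Proof.
move=> df; apply: is_derive_eq (is_derive_chain (1 : R) dfx df) _.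
by case: dx => _ ->.
Qed.

Lemma is_derive_push : is_derive t (1 : R) (T \o x) (push_velocity t).
Proof.
apply: is_derive_rV => m; apply: is_derive_eq (chain_x ((CTm m).1 _ Bt)) _.
by rewrite mxE; apply: eq_bigr => j _; rewrite mxE.
Qed.

Lemma is_derive_push_velocity : is_derive t (1 : R) push_velocity (push_acceleration t).
Proof.
apply: is_derive_rV => m.
have -> : (fun s => push_velocity s ord0 m) =
    (fun s => \sum_j x1 s ord0 j * partial j (fun w => T w ord0 m) (x s)).
  by apply/funext => s; rewrite mxE; apply: eq_bigr => j _; rewrite mxE.
have dx1i j := is_derive_coord j dx1.
have H j := is_deriveM (dx1i j) (chain_x (((CTm m).2 j).1 _ Bt)).
apply: is_derive_eq (is_derive_bigsum H) _.
rewrite big_split /= addrC [RHS]mxE; congr (_ + _).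
  by rewrite mxE; apply: eq_bigr => j _; rewrite mxE /GRing.scale/= mulrC.
rewrite summxE.
under eq_bigr do rewrite /GRing.scale/= mulr_sumr.
rewrite exchange_big; apply: eq_bigr => j _ /=.
rewrite mxE [X in _ = _ * X]mxE mulr_sumr; apply: eq_bigr => k _.
by rewrite partial_mx_jac_mx// mulrCA.
Qed.

Lemma continuous_push_acceleration : {for t, continuous push_acceleration}.
Proof.
apply: continuous_rV => m.
have cx : {for t, continuous x} by exact: differentiable_continuous.
have cx1 : {for t, continuous x1}.
  by case: dx1 => d1 _; exact/differentiable_continuous/derivable1_diffP.
have -> : (fun s => push_acceleration s ord0 m) = (fun s =>
  \sum_j x2 s ord0 j * partial j (fun w => T w ord0 m) (x s) +
  \sum_j x1 s ord0 j * (\sum_k x1 s ord0 k *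
     partial j (partial k (fun w => T w ord0 m)) (x s))).
  apply/funext => s; rewrite mxE; congr (_ + _).
    by rewrite mxE; apply: eq_bigr => j _; rewrite mxE.
  have E j k : partial_mx jac_mx (x s) j k m =
      partial j (partial k (fun w => T w ord0 m)) (x s).
    by rewrite mxE; congr (partial j _ _); apply/funext => w; rewrite mxE.
  rewrite summxE; apply: eq_bigr => j _; rewrite mxE mxE; congr (_ * _).
  by apply: eq_bigr => k _; rewrite E.
apply: continuousD; apply: continuous_bigsum => j; apply: continuousM.
- exact: continuous_entry.
- apply: continuous_comp => //; exact/differentiable_continuous/((CTm m).2 j).1.
- exact: continuous_entry.
apply: continuous_bigsum => k; apply: continuousM; first exact: continuous_entry.
by apply: continuous_comp => //; exact: ((CTm m).2 k).2.
Qed.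

End Curve.

Section Metric.
Variables (g G : 'rV[R]_n -> 'M[R]_n).
Hypothesis gE : forall y, B y -> g y = jac_mx y *m G (T y) *m (jac_mx y)^T.
Variable y : 'rV[R]_n.
Hypotheses (By : B y) (dG : differentiable G (T y)) (sG : (G (T y))^T = G (T y)).

Lemma partial_mx_change a : partial_mx g y a =
  partial_mx jac_mx y a *m G (T y) *m (jac_mx y)^T
  + jac_mx y *m (\sum_r jac_mx y a r *: partial_mx G (T y) r) *m (jac_mx y)^T
  + jac_mx y *m G (T y) *m (partial_mx jac_mx y a)^T.
Proof.
have dJ := is_mderive_jac_mx a By.
have dGT : is_mderive (G \o T) y (delta_mx ord0 a)
    (\sum_r jac_mx y a r *: partial_mx G (T y) r).
  move=> i j.
  have dGij : differentiable (fun w => G w i j) (T y) by exact: differentiable_entry.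
  apply: is_derive_eq (is_derive_chain (delta_mx ord0 a) (CT.1 _ By) dGij) _.
  rewrite summxE; apply: eq_bigr => r _; rewrite !mxE; congr (_ * _).
  by rewrite -(partial_coord _ _ (CT.1 _ By)).
have H := is_mderiveM (is_mderiveM dJ dGT) (is_mderive_tr dJ).
rewrite mulmxDl in H.
apply/matrixP => i j; rewrite mxE -[RHS](@derive_val _ _ _ _ _ _ _ (H i j)).
rewrite /partial; apply: near_eq_derive.
by apply: (open_near_eq oB By) => w; rewrite inE => /gE ->.
Qed.

(** The covariance leaves a factor [(jac_mx y)^T], which is invertible because
    the metric [g y] is nondegenerate. *)
Lemma euler_lagrange_change V A :
  \det (g y) != 0 -> euler_lagrange (g y) (partial_mx g y) V A = 0 ->
  euler_lagrange (G (T y)) (partial_mx G (T y)) (V *m jac_mx y)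
    (A *m jac_mx y + \sum_j V ord0 j *: (V *m partial_mx jac_mx y j)) = 0.
Proof.
move=> dg.
rewrite (euler_lagrange_covariant V A sG (gE By) partial_mx_change); last first.
  move=> a k s; apply: etrans (partial_mx_jac_mx a k s By) _.
  apply: etrans _ (esym (partial_mx_jac_mx k a s By)).
  exact: (schwarz _ _ oB (CTm s) By).
have uJ : (jac_mx y)^T \in unitmx.
  rewrite unitmx_tr unitmxE unitfE; apply: contraNneq dg => J0.
  by rewrite gE// !det_mulmx J0 !mul0r.
by move=> /(congr1 (mulmx^~ (invmx (jac_mx y)^T))); rewrite mulmxK// mul0mx.
Qed.

End Metric.

End Transformation.

(** * From the geodesic equation to the harmonic map equation *)

Section ChristoffelForm.
Variables (R : realType) (n : nat).

(** Raising the index with the inverse metric. The Christoffel symbol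
    symmetrizes the derivative of the metric in the two velocity indices, which
    does not change the sum against [V ord0 j * V ord0 l]. *)
Lemma geodesic_christoffel (G : 'rV[R]_n -> 'M[R]_n) (B : set 'rV[R]_n) y V A :
  open B -> B y -> (forall w, B w -> (G w)^T = G w) -> \det (G y) != 0 ->
  euler_lagrange (G y) (partial_mx G y) V A = 0 ->
  forall i, A ord0 i + \sum_j \sum_l christoffel G y i j l * (V ord0 j * V ord0 l) = 0.
Proof.
move=> oB By sG dG E i.
have uG : G y \in unitmx by rewrite unitmxE unitfE.
have sdG a j l : partial_mx G y a j l = partial_mx G y a l j.
  rewrite !mxE; apply: partial_near; apply: (open_near_eq oB By) => w.
  by rewrite inE => /sG sGw; rewrite -{1}sGw mxE.
have AE : A = - (el_force (partial_mx G y) V *m invmx (G y)).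
  rewrite -[A](mulmxK uG) -mulNmx; congr (_ *m _); apply/eqP.
  by rewrite -addr_eq0; apply/eqP.
have sI l : invmx (G y) l i = invmx (G y) i l.
  by rewrite -[in LHS](sG _ By) -trmx_inv mxE.
rewrite AE mxE mxE.
have forceE l : el_force (partial_mx G y) V ord0 l =
   \sum_j \sum_k 2^-1 * (partial_mx G y j l k + partial_mx G y k l j
      - partial_mx G y l j k) * (V ord0 j * V ord0 k).
  have S1 : (\sum_j V ord0 j *: (V *m partial_mx G y j)) ord0 l =
      \sum_j \sum_k partial_mx G y j l k * (V ord0 j * V ord0 k).
    rewrite summxE; apply: eq_bigr => j _; rewrite mxE mxE mulr_sumr.
    by apply: eq_bigr => k _; rewrite (sdG j k l); ring.
  have S2 : (V *m partial_mx G y l *m V^T) ord0 ord0 =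
      \sum_j \sum_k partial_mx G y l j k * (V ord0 j * V ord0 k).
    rewrite mxE; under eq_bigr do rewrite mxE mulr_suml.
    rewrite exchange_big; apply: eq_bigr => j _; apply: eq_bigr => k _.
    by rewrite [V^T _ _]mxE; ring.
  have S3 : \sum_j \sum_k partial_mx G y k l j * (V ord0 j * V ord0 k) =
      \sum_j \sum_k partial_mx G y j l k * (V ord0 j * V ord0 k).
    rewrite exchange_big; apply: eq_bigr => j _; apply: eq_bigr => k _.
    by rewrite [V ord0 k * _]mulrC.
  rewrite [LHS]mxE [X in _ + X]mxE [X in _ - X]mxE [X in _ - _ * X]mxE S1 S2.
  have -> : \sum_j \sum_k partial_mx G y j l k * (V ord0 j * V ord0 k) =
     2^-1 * (\sum_j \sum_k partial_mx G y j l k * (V ord0 j * V ord0 k)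
      + \sum_j \sum_k partial_mx G y k l j * (V ord0 j * V ord0 k)).
    by rewrite S3; lra.
  rewrite -mulrBr -big_split -sumrB mulr_sumr; apply: eq_bigr => j _ /=.
  rewrite -big_split -sumrB mulr_sumr; apply: eq_bigr => k _ /=; ring.
apply/eqP; rewrite addrC subr_eq0; apply/eqP.
under [RHS]eq_bigr do rewrite forceE mulr_suml.
rewrite [RHS]exchange_big; apply: eq_bigr => j _ /=.
under [RHS]eq_bigr do rewrite mulr_suml.
rewrite [RHS]exchange_big; apply: eq_bigr => k _ /=.
rewrite /christoffel mulr_sumr mulr_suml; apply: eq_bigr => l _.
rewrite sI !mxE; ring.
Qed.

End ChristoffelForm.

Section ComplexDerivatives.
Variable R : realType.
Local Open Scope complex_scope.
Implicit Types (f : 'rV[R]_2 -> R) (u : 'rV[R]_2).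

Let half_complex (a b c d : R) :
  ((a +i* b) - 'i%C * (c +i* d)) / 2%:R = ((a + d) / 2) +i* ((b - c) / 2) :> R[i].
Proof.
have -> : (2%:R : R[i]) = 2%:C by rewrite rmorph_nat.
rewrite -fmorphV; simpc; congr (_ +i* _); ring.
Qed.

Let half_complex_bar (a b c d : R) :
  ((a +i* b) + 'i%C * (c +i* d)) / 2%:R = ((a - d) / 2) +i* ((b + c) / 2) :> R[i].
Proof.
have -> : (2%:R : R[i]) = 2%:C by rewrite rmorph_nat.
rewrite -fmorphV; simpc; congr (_ +i* _); ring.
Qed.

Lemma d_zE (h : 'rV[R]_2 -> R[i]) u :
  d_z h u =
  ((partial ord0 (fun w => complex.Re (h w)) u
    + partial ord_max (fun w => complex.Im (h w)) u) / 2) +i*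
  ((partial ord0 (fun w => complex.Im (h w)) u
    - partial ord_max (fun w => complex.Re (h w)) u) / 2).
Proof. exact: half_complex. Qed.

Lemma d_zbarE (h : 'rV[R]_2 -> R[i]) u :
  d_zbar h u =
  ((partial ord0 (fun w => complex.Re (h w)) u
    - partial ord_max (fun w => complex.Im (h w)) u) / 2) +i*
  ((partial ord0 (fun w => complex.Im (h w)) u
    + partial ord_max (fun w => complex.Re (h w)) u) / 2).
Proof. exact: half_complex_bar. Qed.

Lemma d_z_real f u : d_z (fun w => (f w)%:C) u =
  (partial ord0 f u / 2) +i* (- partial ord_max f u / 2).
Proof.
by rewrite d_zE /= /partial !derive_cst addr0 sub0r.
Qed.

Lemma d_zbar_real f u : d_zbar (fun w => (f w)%:C) u =
  (partial ord0 f u / 2) +i* (partial ord_max f u / 2).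
Proof.
by rewrite d_zbarE /= /partial !derive_cst subr0 add0r.
Qed.

Lemma partial_half f j u : differentiable f u ->
  partial j (fun w => f w / 2) u = partial j f u / 2.
Proof.
move=> df; rewrite /partial.
have -> : (fun w => f w / 2) = 2^-1 *: f.
  by apply/funext => w; rewrite mulrC.
apply: etrans (deriveZ _ (diff_derivable df)) _; exact: mulrC.
Qed.

(** The real part is a quarter of the Laplacian; the imaginary part, which
    vanishes by Schwarz's theorem, is kept as it stands. *)
Lemma d_z_d_zbar_real f (O : set 'rV[R]_2) u : Ck 2 O f -> O u ->
  d_z (d_zbar (fun w => (f w)%:C)) u =
  ((partial ord0 (partial ord0 f) u + partial ord_max (partial ord_max f) u) / 4)
  +i* ((partial ord0 (partial ord_max f) u - partial ord_max (partial ord0 f) u) / 4).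
Proof.
move=> Cf Ou; rewrite d_zE.
have -> : (fun w => complex.Re (d_zbar (fun w => (f w)%:C) w)) =
    (fun w => partial ord0 f w / 2).
  by apply/funext => w; rewrite d_zbar_real.
have -> : (fun w => complex.Im (d_zbar (fun w => (f w)%:C) w)) =
    (fun w => partial ord_max f w / 2).
  by apply/funext => w; rewrite d_zbar_real.
have half j k := @partial_half (partial j f) k u ((Cf.2 j).1 u Ou).
have quarter (a b c d a' b' c' d' : R) :
    a' = a / 2 -> b' = b / 2 -> c' = c / 2 -> d' = d / 2 ->
    ((a' + b') / 2) +i* ((c' - d') / 2) = ((a + b) / 4) +i* ((c - d) / 4).
  by move=> -> -> -> ->; congr (_ +i* _); lra.
by apply: quarter; exact: half.
Qed.

Lemma real_complex_product (c a b x y : R) :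
  c%:C * ((a * x / 2) +i* (- (a * y) / 2)) * ((b * x / 2) +i* (b * y / 2)) =
  (c * (a * b) * ((x ^+ 2 + y ^+ 2) / 4))%:C.
Proof. by simpc; congr (_ +i* _); field. Qed.

End ComplexDerivatives.

Section HarmonicCurve.
Local Open Scope complex_scope.
Variables (R : realType) (n : nat) (O : set 'rV[R]_2) (I : set R).
Variables (h : 'rV[R]_2 -> R) (s s1 s2 : R -> 'rV[R]_n).
Hypotheses (oO : open O) (Ch : Ck 2 O h) (OI : forall u, O u -> I (h u)).
Hypothesis ds : forall t, I t -> is_derive t (1 : R) s (s1 t).
Hypothesis ds1 : forall t, I t -> is_derive t (1 : R) s1 (s2 t).
Hypothesis cs2 : forall t, I t -> {for t, continuous s2}.

Let dsi i t (It : I t) := is_derive_coord i (ds It).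
Let ds1i i t (It : I t) := is_derive_coord i (ds1 It).
Let cs2i i t (It : I t) : {for t, continuous (fun x => s2 x ord0 i)} :=
  continuous_entry (cs2 It).

Lemma Ck2_curve_rV : Ck 2 O (s \o h).
Proof.
apply: (Ck_rV oO) => i.
exact: (Ck2_curve_comp oO Ch OI (@dsi i) (@ds1i i) (@cs2i i)).
Qed.

Lemma partial_curve_rV a u : O u ->
  partial a (s \o h) u = partial a h u *: s1 (h u).
Proof.
move=> Ou; apply/rowP => i; rewrite (partial_coord _ _ (Ck2_curve_rV.1 _ Ou)).
apply: etrans (partial_curve_comp Ch OI (@dsi i) a Ou) _.
by rewrite mxE mulrC.
Qed.

(** If [h] is harmonic, the Laplacian of [s \o h] is [s2] times the squared
    length of the gradient of [h], and the product of the first derivatives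
    yields the same factor; so the harmonic map equation at [u] is the geodesic
    equation at [h u] multiplied by a quarter of it. *)
Lemma harmonic_curve (G : 'rV[R]_n -> 'M[R]_n) u : O u ->
  partial ord0 (partial ord0 h) u + partial ord_max (partial ord_max h) u = 0 ->
  (forall i, s2 (h u) ord0 i + \sum_j \sum_l christoffel G (s (h u)) i j l *
     (s1 (h u) ord0 j * s1 (h u) ord0 l) = 0) ->
  harmonic_eq G (s \o h) u.
Proof.
move=> Ou lap geo FC i; rewrite {}/FC.
have Cs : Ck 2 O (fun w => s (h w) ord0 i).
  exact: (Ck2_curve_comp oO Ch OI (@dsi i) (@ds1i i) (@cs2i i)).
have p1 a j : partial a (fun w => s (h w) ord0 j) u = s1 (h u) ord0 j * partial a h u.
  exact: (partial_curve_comp Ch OI (@dsi j) a Ou).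
have p2 a b : partial b (partial a (fun w => s (h w) ord0 i)) u =
    s2 (h u) ord0 i * partial b h u * partial a h u +
    s1 (h u) ord0 i * partial b (partial a h) u.
  exact: (partial2_curve_comp oO Ch OI (@dsi i) (@ds1i i) a b Ou).
have sym := schwarz ord0 ord_max oO Ch Ou.
set h0 := partial ord0 h u in p1 p2; set h1 := partial ord_max h u in p1 p2.
have termE j l : (christoffel G (s (h u)) i j l)%:C *
    d_z (fun w => (s (h w) ord0 j)%:C) u * d_zbar (fun w => (s (h w) ord0 l)%:C) u =
    (christoffel G (s (h u)) i j l * (s1 (h u) ord0 j * s1 (h u) ord0 l)
     * ((h0 ^+ 2 + h1 ^+ 2) / 4))%:C.
  rewrite d_z_real d_zbar_real (p1 ord0 j) (p1 ord_max j) (p1 ord0 l) (p1 ord_max l).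
  exact: real_complex_product.
under eq_bigr do under eq_bigr do rewrite termE.
under eq_bigr do rewrite -rmorph_sum -mulr_suml.
rewrite -rmorph_sum -mulr_suml.
apply: etrans (congr1 (fun x => x + _) (d_z_d_zbar_real Cs Ou)) _.
rewrite (p2 ord0 ord0) (p2 ord_max ord_max) (p2 ord_max ord0) (p2 ord0 ord_max) sym.
move: lap (geo i); rewrite -/h0 -/h1.
move: (partial ord0 (partial ord0 h) u) (partial ord_max (partial ord_max h) u).
move: (partial ord_max (partial ord0 h) u) (\sum_j _) => m S a b ab gi.
have -> : S = - s2 (h u) ord0 i by apply/eqP; rewrite -addr_eq0 addrC gi.
have -> : b = - a by apply/eqP; rewrite -addr_eq0 addrC ab.
by apply/eqP; rewrite eq_complex /=; apply/andP; split; apply/eqP; field.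
Qed.

End HarmonicCurve.

(** * Charts and the geodesic map *)

Section Charts.
Variables (R : realType) (n : nat) (M : topologicalType).
Implicit Types c d : chart R n M.

Lemma chart_image_open c (W : set M) :
  open W -> W `<=` chart_dom c -> open (chart_coord c @` W).
Proof.
move=> oW Wc; rewrite openE => u [q Wq uE].
have imu : (chart_coord c @` chart_dom c) u by exists q => //; exact: Wc.
have nW : nbhs (chart_param c u) W.
  rewrite -uE chart_coordK; last exact: Wc.
  exact: open_nbhs_nbhs (conj oW Wq).
have n1 : nbhs u (chart_param c @^-1` W) := chart_paramC imu nW.
have n2 := open_nbhs_nbhs (conj (@chart_img_open _ _ _ c) imu).
apply: filterS (filterI n1 n2) => w [/= Ww [q' cq' wE]].
by exists (chart_param c w) => //; rewrite -wE chart_coordK.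
Qed.

Lemma overlap_open c d : open (chart_coord c @` (chart_dom c `&` chart_dom d)).
Proof.
apply: chart_image_open; last by move=> q [].
by apply: openI; exact: chart_dom_open.
Qed.

Lemma transitionE c d q : chart_dom c q ->
  transition c d (chart_coord c q) = chart_coord d q.
Proof. by move=> cq; rewrite /transition /= chart_coordK. Qed.

End Charts.

Section Metric.
Variables (R : realType) (k n : nat) (N : topologicalType).
Variable Y : riemannian_manifold R k n N.

Lemma metric_det c q : rm_atlas Y c -> chart_dom c q ->
  \det (rm_metric Y c (chart_coord c q)) != 0.
Proof.
move=> Ac cq; apply/negP => /det0P[w w0 wg].
have := rm_metric_pos Ac cq w0.
by rewrite wg mul0mx mxE ltxx.
Qed.

End Metric.

Section ReHolomorphic.
Variables (R : realType) (f : 'rV[R]_2 -> 'rV[R]_2) (O : set 'rV[R]_2).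
Hypotheses (oO : open O) (hf : holomorphic O f).

Lemma Ck_holomorphic_coord k i : Ck k O (fun u => f u ord0 i).
Proof. by apply: (Ck_entry _ _ oO); exact: hf.1. Qed.

Lemma cauchy_riemann u : O u ->
  partial ord0 (fun w => f w ord0 ord0) u = partial ord_max (fun w => f w ord0 ord_max) u
  /\ partial ord_max (fun w => f w ord0 ord0) u =
     - partial ord0 (fun w => f w ord0 ord_max) u.
Proof.
move=> Ou; have := hf.2 _ Ou; rewrite d_zbarE /= => /eqP.
rewrite eq_complex /= => /andP[/eqP E1 /eqP E2]; split; move: E1 E2.
  by move=> /eqP; rewrite mulf_eq0 invr_eq0 pnatr_eq0 orbF subr_eq0 => /eqP.
move=> _ /eqP; rewrite mulf_eq0 invr_eq0 pnatr_eq0 orbF addrC addr_eq0 => /eqP.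
exact.
Qed.

(** Cauchy-Riemann and the symmetry of the mixed derivatives of the imaginary
    part. *)
Lemma re_holomorphic_laplace u : O u ->
  partial ord0 (partial ord0 (fun w => f w ord0 ord0)) u +
  partial ord_max (partial ord_max (fun w => f w ord0 ord0)) u = 0.
Proof.
move=> Ou; set f0 := fun w => f w ord0 ord0; set f1 := fun w => f w ord0 ord_max.
have E0 : partial ord0 (partial ord0 f0) u = partial ord0 (partial ord_max f1) u.
  apply: partial_near; apply: (open_near_eq oO Ou) => w; rewrite inE => Ow.
  exact: (cauchy_riemann Ow).1.
have E1 : partial ord_max (partial ord_max f0) u = - partial ord_max (partial ord0 f1) u.
  have -> : partial ord_max (partial ord_max f0) u =
      partial ord_max (- (partial ord0 f1)) u.
    apply: partial_near; apply: (open_near_eq oO Ou) => w; rewrite inE => Ow.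
    exact: (cauchy_riemann Ow).2.
  apply: deriveN; apply: diff_derivable.
  exact: ((Ck_holomorphic_coord 2 ord_max).2 ord0).1.
apply: etrans (congr2 +%R E0 E1) _.
have sym := schwarz ord0 ord_max oO (Ck_holomorphic_coord 2 ord_max) Ou.
by apply/eqP; rewrite subr_eq0; apply/eqP.
Qed.

End ReHolomorphic.

(** The map is the geodesic evaluated at the first coordinate in the chart [z].
    In charts [z'] and [d] its representative is by definition the image of the
    curve [x] under the transition map from [c] to [d], composed with the real
    part of the holomorphic transition map from [z'] to [z]. *)
Section GeodesicMap.
Variables (R : realType) (S : topologicalType) (X : riemann_surface R S).
Variables (n : nat) (N : topologicalType) (Y : riemannian_manifold R 3 n N).
Variables (z : chart R 2 S) (hz : rs_atlas X z) (c : chart R n N) (hc : rm_atlas Y c).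
Variables (x x1 x2 : R -> 'rV[R]_n) (x0 b : R).

Let img := chart_coord c @` chart_dom c.
Let g := rm_metric Y c.

Hypothesis geo : forall t, `|t - x0| < b ->
     [/\ img (x t), is_derive t (1 : R) x (x1 t), is_derive t (1 : R) x1 (x2 t),
         {for t, continuous x2} &
         euler_lagrange (g (x t)) (partial_mx g (x t)) (x1 t) (x2 t) = 0].

Definition strip : set S :=
  [set q | chart_dom z q /\ `|chart_coord z q ord0 ord0 - x0| < b].

Definition geodesic_map (q : S) : N := chart_param c (x (chart_coord z q ord0 ord0)).

Let re_continuous q : chart_dom z q ->
  {for q, continuous (fun q => chart_coord z q ord0 ord0)}.
Proof. by move=> zq; apply: continuous_entry; exact: chart_coordC. Qed.

Lemma strip_open : open strip.
Proof.
rewrite openE => q [zq qb].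
have n1 := open_nbhs_nbhs (conj (@chart_dom_open _ _ _ z) zq).
have e0 : 0 < b - `|chart_coord z q ord0 ord0 - x0| by rewrite subr_gt0.
have /cvgrPdist_lt/(_ _ e0) n2 := re_continuous zq.
apply: filterS (filterI n1 n2) => w [zw wb]; split=> //.
move: wb; move: (chart_coord z q ord0 ord0) (chart_coord z w ord0 ord0) => s t.
move=> st; have -> : t - x0 = (s - x0) - (s - t) by ring.
by apply: le_lt_trans (ler_normB _ _) _; rewrite -ltrBrDl.
Qed.

Lemma geodesic_map_continuous q : strip q -> {for q, continuous geodesic_map}.
Proof.
move=> [zq qb]; have [ix [dx _] _ _ _] := geo qb.
have cx : {for chart_coord z q ord0 ord0, continuous x}.
  exact/differentiable_continuous/derivable1_diffP.
apply: (@continuous_comp _ _ _ (fun q => x (chart_coord z q ord0 ord0)) (chart_param c)).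
  apply: (@continuous_comp _ _ _ (fun q => chart_coord z q ord0 ord0) x).
    exact: re_continuous.
  exact: cx.
exact: chart_paramC.
Qed.

Lemma geodesic_map_dom q : strip q -> chart_dom c (geodesic_map q).
Proof.
move=> [zq qb]; have [[w cw wE] _ _ _ _] := geo qb.
by rewrite /geodesic_map -wE chart_coordK.
Qed.

Lemma geodesic_map_coord q : strip q ->
  chart_coord c (geodesic_map q) = x (chart_coord z q ord0 ord0).
Proof.
move=> [zq qb]; have [[w cw wE] _ _ _ _] := geo qb.
by rewrite /geodesic_map -wE chart_coordK.
Qed.

Section LocalRep.
Variables (z' : chart R 2 S) (hz' : rs_atlas X z') (d : chart R n N) (hd : rm_atlas Y d).

Let O := local_dom z' d strip geodesic_map.
Let T := transition c d.
Let B := chart_coord c @` (chart_dom c `&` chart_dom d).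
Let Z := chart_coord z' @` (chart_dom z' `&` chart_dom z).
Let h u := transition z' z u ord0 ord0.
Let I := [set t | `|t - x0| < b /\ B (x t)].
Let s := T \o x.
Let s1 := push_velocity T x x1.
Let s2 := push_acceleration T x x1 x2.

Let local_repE : local_rep z' d geodesic_map = s \o h.
Proof. by []. Qed.

Lemma geodesic_map_local_dom_open : open O.
Proof.
apply: chart_image_open; last by move=> q [[]].
rewrite openE => q [[zq Uq] dq].
have n1 := open_nbhs_nbhs (conj (@chart_dom_open _ _ _ z') zq).
have n2 := open_nbhs_nbhs (conj strip_open Uq).
have n3 : nbhs q (geodesic_map @^-1` chart_dom d).
  have nd := open_nbhs_nbhs (conj (@chart_dom_open _ _ _ d) dq).
  exact: (geodesic_map_continuous Uq nd).
by apply: filterS (filterI (filterI n1 n2) n3).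
Qed.

Let oB : open B. Proof. exact: overlap_open. Qed.

Let oZ : open Z. Proof. exact: overlap_open. Qed.

Let OZ : O `<=` Z.
Proof. by move=> _ [q [[z'q [zq _]] _] <-]; exists q. Qed.

Let OI u : O u -> I (h u).
Proof.
move=> [q [[z'q Uq] dq] <-]; rewrite /h transitionE//; split; first by case: Uq.
exists (geodesic_map q); last exact: geodesic_map_coord.
by split=> //; exact: geodesic_map_dom.
Qed.

Let hol : holomorphic Z (transition z' z).
Proof. by have [_ /(_ _ _ hz' hz)[]] := rs_atlasP X. Qed.

Let Ch : Ck 2 O h.
Proof. by apply: Ck_subset OZ _; exact: (Ck_holomorphic_coord oZ hol). Qed.

Let CT : Ck 2 B T.
Proof.
have [_ /(_ _ _ hc hd)[C3 _] _] := rm_atlasP Y.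
exact: (@CkW _ _ _ 2 _ _ C3).
Qed.

Let ds t : I t -> is_derive t (1 : R) s (s1 t).
Proof.
by move=> [tb Bt]; have [_ dx _ _ _] := geo tb; exact: (is_derive_push oB CT Bt dx).
Qed.

Let ds1 t : I t -> is_derive t (1 : R) s1 (s2 t).
Proof.
move=> [tb Bt]; have [_ dx dx1 _ _] := geo tb.
exact: (is_derive_push_velocity oB CT Bt dx dx1).
Qed.

Let cs2 t : I t -> {for t, continuous s2}.
Proof.
move=> [tb Bt]; have [_ dx dx1 cx2 _] := geo tb.
exact: (continuous_push_acceleration oB CT Bt dx dx1 cx2).
Qed.

Lemma geodesic_map_Ck2 : Ck 2 O (local_rep z' d geodesic_map).
Proof.
rewrite local_repE.
exact: (Ck2_curve_rV geodesic_map_local_dom_open Ch OI ds ds1 cs2).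
Qed.

Lemma partial_geodesic_map a u : O u ->
  partial a (local_rep z' d geodesic_map) u = partial a h u *: s1 (h u).
Proof.
move=> Ou; rewrite local_repE.
exact: (partial_curve_rV geodesic_map_local_dom_open Ch OI ds ds1 cs2).
Qed.

(** Invariance under changes of both coordinates: the image of the curve is a
    geodesic for the metric in the chart [d] by covariance of the
    Euler-Lagrange equation, and the real part of a holomorphic function is
    harmonic. *)
Lemma geodesic_map_harmonic_eq u : O u ->
  harmonic_eq (rm_metric Y d) (local_rep z' d geodesic_map) u.
Proof.
move=> Ou; rewrite local_repE.
apply: (harmonic_curve geodesic_map_local_dom_open Ch OI ds ds1 cs2 Ou).
  exact: (re_holomorphic_laplace oZ hol (OZ Ou)).
have [tb Bt] := OI Ou; have [_ _ _ _ EL] := geo tb.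
have [q [cq dq] qE] := Bt.
have TE : T (x (h u)) = chart_coord d q by rewrite -qE /T transitionE.
have imT : (chart_coord d @` chart_dom d) (T (x (h u))) by rewrite TE; exists q.
have sG w : (chart_coord d @` chart_dom d) w -> (rm_metric Y d w)^T = rm_metric Y d w.
  by move=> [q' dq' <-]; exact: rm_metric_sym.
apply: (geodesic_christoffel (@chart_img_open _ _ _ d) imT sG).
  by rewrite /s /= TE; exact: metric_det.
apply: (euler_lagrange_change oB CT _ Bt _ _ _ EL).
- move=> y By; have [q' [cq' dq'] q'E] := By.
  rewrite -(jacobian_jac_mx CT By) -q'E /T transitionE//.
  exact: rm_metric_change.
- exact: (rm_metric_Ck hd).1.
- exact: sG.
- by rewrite -qE; exact: metric_det.
Qed.

End LocalRep.

Lemma geodesic_map_harmonic : harmonic_map X Y strip geodesic_map.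
Proof.
split; last by move=> z' d hz' hd u; exact: geodesic_map_harmonic_eq.
split; first exact: geodesic_map_continuous.
by move=> z' d hz' hd; exact: geodesic_map_Ck2.
Qed.

(** With [z' = z] the transition map is the identity, so the first coordinate
    has derivative 1 along itself and the differential is the velocity of the
    geodesic, transported from [c] to [d] like a tangent vector. *)
Lemma geodesic_map_differential z0 p (v : tangent Y p) :
  chart_dom z z0 -> chart_coord z z0 ord0 ord0 = x0 -> 0 < b ->
  chart_dom c p -> x x0 = chart_coord c p -> x1 x0 = tcomp v c ->
  differential_x geodesic_map z z0 v.
Proof.
move=> zz0 E0 b0 cp xE x1E d hd dp.
have U0 : strip z0 by split=> //; rewrite E0 subrr normr0.
have phi0 : geodesic_map z0 = p by rewrite /geodesic_map E0 xE chart_coordK.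
have Ou : local_dom z d strip geodesic_map (chart_coord z z0).
  by exists z0 => //; split; [split|rewrite /preimage/= phi0].
have dF := (geodesic_map_Ck2 hz hd).1 _ Ou.
rewrite -deriveE// -[LHS]/(partial ord0 (local_rep z d geodesic_map) (chart_coord z z0)).
rewrite (partial_geodesic_map hz hd ord0 Ou) transitionE// E0.
have -> : partial ord0 (fun u => transition z z u ord0 ord0) (chart_coord z z0) = 1.
  have oz := @chart_img_open _ _ _ z.
  have uz : (chart_coord z @` chart_dom z) (chart_coord z z0) by exists z0.
  have -> : partial ord0 (fun u => transition z z u ord0 ord0) (chart_coord z z0) =
      partial ord0 (fun u : 'rV[R]_2 => u ord0 ord0) (chart_coord z z0).
    apply: partial_near; apply: (open_near_eq oz uz) => w; rewrite inE => -[q zq <-].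
    by rewrite transitionE.
  have := @derive_coord _ _ _ id (chart_coord z z0) (delta_mx ord0 ord0) ord0.
  rewrite derive_id mxE !eqxx => /(_ (@derivable_id _ _ _ _)) E.
  exact: esym E.
have Bp : (chart_coord c @` (chart_dom c `&` chart_dom d)) (chart_coord c p) by exists p.
have CT : Ck 2 (chart_coord c @` (chart_dom c `&` chart_dom d)) (transition c d).
  have [_ /(_ _ _ hc hd)[C3 _] _] := rm_atlasP Y.
  exact: (@CkW _ _ _ 2 _ _ C3).
rewrite scale1r /push_velocity xE x1E -(jacobian_jac_mx CT Bp) /jacobian mul_rV_lin1.
by rewrite -tcomp_change.
Qed.

End GeodesicMap.

Theorem theoremC (R : realType)
    (S : topologicalType) (X : riemann_surface R S)
    (n : nat) (N : topologicalType) (Y : riemannian_manifold R 3 n N)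
    (z0 : S) (p : N) (v : tangent Y p)
    (z : chart R 2 S) (hz : rs_atlas X z) (hz0 : chart_dom z z0) :
  exists (U : set S) (phi : S -> N),
    [/\ open U, U z0, harmonic_map X Y U phi, phi z0 = p
      & differential_x phi z z0 v].
Proof.
have [/(_ p)[c hc cp] _ _] := rm_atlasP Y.
have imp : (chart_coord c @` chart_dom c) (chart_coord c p) by exists p.
have Cg : Ck 2 (chart_coord c @` chart_dom c) (rm_metric Y c) := rm_metric_Ck hc.
have dg y : (chart_coord c @` chart_dom c) y -> \det (rm_metric Y c y) != 0.
  by move=> [q cq <-]; exact: metric_det.
have [b b0 [x [x1 [x2 [xE x1E geo]]]]] := geodesic_exists (@chart_img_open _ _ _ c)
  Cg dg (tcomp v c) (chart_coord z z0 ord0 ord0) imp.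
exists (strip z (chart_coord z z0 ord0 ord0) b), (geodesic_map z c x); split.
- exact: strip_open.
- by split; rewrite // subrr normr0.
- exact: (geodesic_map_harmonic hz hc geo).
- by rewrite /geodesic_map xE chart_coordK.
- exact: (geodesic_map_differential hz hc geo).
Qed.
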